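(* Let $N,m\geq 1$ be integers. (a) If $q\geq 1$, $r\in(0,q)$ and $u\in L^q(\mathbb{R}^N,\mathbb{R}^m)$, then $u\in B_{q,\infty}^{r/q}(\mathbb{R}^N,\mathbb{R}^m)$ if and only if $$\limsup_{\varepsilon\to0^+}\Big\{\int_{S^{N-1}}\int_{\mathbb{R}^N}\frac{|u(x+\varepsilon n)-u(x)|^q}{\varepsilon^r}\,dx\,d\mathcal{H}^{N-1}(n)\Big\}<+\infty.$$ (b) If $\Omega\subset\mathbb{R}^N$ is an open set, $q\geq 1$, $r\in(0,q)$ and $u\in L^q_{loc}(\Omega,\mathbb{R}^m)$, then $u\in\big(B_{q,\infty}^{r/q}\big)_{loc}(\Omega,\mathbb{R}^m)$ if and only if for every open set $G\subset\subset\Omega$, $$\limsup_{\varepsilon\to0^+}\Big\{\int_{S^{N-1}}\int_G\chi_G(x+\varepsilon n)\frac{|u(x+\varepsilon n)-u(x)|^q}{\varepsilon^r}\,dx\,d\mathcal{H}^{N-1}(n)\Big\}<+\infty.$$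
   Context: Besov spaces: for $q\geq1$ and $s\in(0,1)$, $u\in L^q(\mathbb{R}^N,\mathbb{R}^m)$ belongs to $B^s_{q,\infty}(\mathbb{R}^N,\mathbb{R}^m)$ if $$\sup_{\rho\in(0,\infty)}\Big(\sup_{|h|\leq\rho}\int_{\mathbb{R}^N}\frac{|u(x+h)-u(x)|^q}{\rho^{sq}}\,dx\Big)<+\infty.$$ For an open $\Omega\subset\mathbb{R}^N$, $u\in L^q_{loc}(\Omega,\mathbb{R}^m)$ belongs to $(B^s_{q,\infty})_{loc}(\Omega,\mathbb{R}^m)$ if for every compact $K\subset\subset\Omega$ there exists $u_K\in B^s_{q,\infty}(\mathbb{R}^N,\mathbb{R}^m)$ such that $u_K(x)=u(x)$ for every $x\in K$. $G\subset\subset\Omega$ means that $\overline G$ is compact and contained in $\Omega$. $\chi_G$ is the indicator function of $G$ (equal to $1$ on $G$ and $0$ on $\mathbb{R}^N\setminus G$), and the integrand with factor $\chi_G(x+\varepsilon n)$ is $0$ when $x+\varepsilon n\notin G$. $\mathcal{H}^{N-1}$ is the $(N-1)$-dimensional Hausdorff measure and $S^{N-1}$ is the unit sphere in $\mathbb{R}^N$. *)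

(* Defs.v *)
From HB Require Import structures.
From mathcomp Require Import all_boot all_order all_algebra.
From mathcomp Require Import all_classical all_reals all_analysis.

Set Implicit Arguments.
Unset Strict Implicit.
Unset Printing Implicit Defensive.
Import Order.TTheory GRing.Theory Num.Theory.
Import numFieldNormedType.Exports.

Local Open Scope classical_set_scope.
Local Open Scope ring_scope.

(* The library's norm `|x| on row vectors is the sup norm, hence this one. *)
Definition enorm (R : realType) (n : nat) (x : 'rV[R]_n) : R :=
  Num.sqrt (\sum_(i < n) x 0 i ^+ 2).

Definition unit_sphere (R : realType) (n : nat) : set 'rV[R]_n :=
  [set x | enorm x = 1].

(* Outer measure defined by the infimum of \sum_k g (F k) over the at most
   countable covers of A by sets S (F k) with F k in P.  An index k with
   F k = None is unused, which allows finite and empty covers. *)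
Section cover_outer.
Context (R : realType) (T I : Type).
Variables (P : set I) (S : I -> set T) (g : I -> \bar R).
Local Open Scope ereal_scope.

Definition cover_outer (A : set T) : \bar R :=
  ereal_inf [set \sum_(k <oo) oapp g 0 (F k) | F in
    [set F : nat -> option I | (forall k i, F k = Some i -> P i) /\
                               A `<=` \bigcup_k oapp S set0 (F k)]].

Hypothesis g_ge0 : forall i, P i -> 0 <= g i.

Let og_ge0 (F : nat -> option I) : (forall k i, F k = Some i -> P i) ->
  forall k, 0 <= oapp g 0 (F k).
Proof. by move=> PF k; case E : (F k) => //=; apply: g_ge0; exact: PF E. Qed.

Lemma cover_outer_ge0 A : 0 <= cover_outer A.
Proof.
by apply: le_ereal_inf_tmp => x [F [PF _] <-]; apply: nneseries_ge0 => k *;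
  exact: og_ge0.
Qed.

Lemma cover_outer0 : cover_outer set0 = 0.
Proof.
apply/eqP; rewrite eq_le cover_outer_ge0 andbT.
apply: ereal_inf_lbound; exists (fun=> None); first by split.
by rewrite eseries0.
Qed.

Lemma le_cover_outer : {homo cover_outer : A B / A `<=` B >-> A <= B}.
Proof.
move=> A B AB; apply/ereal_inf_le_tmp => x [F [PF BF]] <-{x}.
by exists F => //; split => //; exact: subset_trans BF.
Qed.

Lemma cover_outer_sigma_subadditive : sigma_subadditive cover_outer.
Proof.
move=> A; have [[i ioo]|] := pselect (exists i, cover_outer (A i) = +oo).
  rewrite (eseries_pinfty _ _ ioo) ?leey// => n _.
  by rewrite -ltNye (lt_le_trans _ (cover_outer_ge0 _)).
rewrite -forallNE => Aoo.
suff add2e (e : {posnum R}) :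
    cover_outer (\bigcup_n A n) <= \sum_(i <oo) cover_outer (A i) + e%:num%:E.
  by apply/lee_addgt0Pr => _/posnumP[].
rewrite (le_trans _ (epsilon_trick _ _ _))//; last first.
  by move=> n; exact: cover_outer_ge0.
pose Q n (B : nat -> option I) := [/\ forall k i, B k = Some i -> P i,
  A n `<=` \bigcup_k oapp S set0 (B k) &
  \sum_(k <oo) oapp g 0 (B k) <=
    cover_outer (A n) + (e%:num / (2 ^ n.+1)%:R)%:E].
have [G QG] : {G : nat -> nat -> option I & forall n, Q n (G n)}.
  apply: (@choice _ _ Q) => n; rewrite /Q.
  have en1 : (0 < e%:num / (2 ^ n.+1)%:R)%R by [].
  have fA : cover_outer (A n) \is a fin_num.
    by rewrite ge0_fin_numE ?cover_outer_ge0// ltey; apply/eqP; exact: Aoo.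
  have [x [B [PB AB] <-]] := lb_ereal_inf_adherent en1 fA.
  by move=> /ltW; exists B.
pose h x := oapp g 0 (uncurry G x).
have h_ge0 x : 0 <= h x.
  by case: x => n k; rewrite /h /uncurry/=; apply: og_ge0; case: (QG n).
apply: (@le_trans _ _ (\esum_(i in setT) h i)).
  apply: ereal_inf_lbound => /=.
  have /card_esym/ppcard_eqP[f] := card_nat2.
  exists (uncurry G \o f).
    split => [k i|]; first by rewrite /= /uncurry; case: (f k) => a b;
      case: (QG a) => + _ _; exact.
    move=> t [i _ Ait]; have [_ /(_ _ Ait)[j _ St] _] := QG i.
    by exists (f^-1%FUN (i, j)) => //=; rewrite invK ?inE.
  rewrite -(esum_pred_image h _ xpredT) ?[fun=> _]set_true//.
  by rewrite image_eq.
rewrite (_ : esum _ _ = \sum_(i <oo) \sum_(j <oo ) h (i, j)); last first.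
  pose J : nat -> set (nat * nat) := fun i => [set (i, j) | j in setT].
  rewrite (_ : setT = \bigcup_k J k); last first.
    by rewrite predeqE => -[a b]; split => // _; exists a => //; exists b.
  rewrite esum_bigcupT /=; last 2 first.
    - apply/trivIsetP => i j _ _ ij.
      rewrite predeqE => -[n m] /=; split => //= -[] [_] _ [<-{n} _].
      by move=> [m' _] [] /esym/eqP; rewrite (negbTE ij).
    - by move=> /= [n m]; exact: h_ge0.
  rewrite -(image_id [set: nat]) -fun_true esum_pred_image//; last first.
    by move=> n _; exact: esum_ge0.
  apply: eq_eseriesr => /= j _.
  rewrite -(esum_pred_image h (pair j) predT)//=; last first.
    by move=> ? ? _ _; exact: (@can_inj _ _ _ snd).
  by congr esum; rewrite predeqE => -[a b]; split; move=> [i _ <-]; exists i.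
apply: lee_lim.
- apply: is_cvg_nneseries => n *.
  by apply: nneseries_ge0 => m *; exact: (h_ge0 (n, m)).
- apply: is_cvg_nneseries => n *; apply: adde_ge0 => //.
  exact: cover_outer_ge0.
- by near=> n; apply: lee_sum => i _; have [] := QG i.
Unshelve. all: by end_near. Qed.

End cover_outer.

Definition box (R : realType) (n : nat) (ab : 'rV[R]_n * 'rV[R]_n) :
    set 'rV[R]_n :=
  [set x | forall i, ab.1 0 i < x 0 i <= ab.2 0 i].

(* The truncation gives volume 0 to a box that is empty because its corners are
   in the wrong order. *)
Definition box_volume (R : realType) (n : nat) (ab : 'rV[R]_n * 'rV[R]_n) :
    \bar R :=
  (\prod_(i < n) Num.max 0 (ab.2 0 i - ab.1 0 i))%:E.

Definition lebesgue_outer (R : realType) (n : nat) : set 'rV[R]_n -> \bar R :=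
  cover_outer setT (@box R n) (@box_volume R n).

Section lebesgue_rV_instances.
Context (R : realType) (n : nat).
Local Open Scope ereal_scope.

Lemma box_volume_ge0 (ab : 'rV[R]_n * 'rV[R]_n) :
  [set: 'rV[R]_n * 'rV[R]_n] ab -> 0 <= box_volume ab.
Proof. by move=> _; rewrite lee_fin prodr_ge0// => i _; rewrite le_max lexx. Qed.

HB.instance Definition _ := isOuterMeasure.Build R 'rV[R]_n (@lebesgue_outer R n)
  (cover_outer0 _ box_volume_ge0) (cover_outer_ge0 _ box_volume_ge0)
  (@le_cover_outer _ _ _ _ _ _)
  (cover_outer_sigma_subadditive _ box_volume_ge0).

(* A copy of 'rV[R]_n whose measurable sets are the Lebesgue measurable sets. *)
Definition lebesgueType : measurableType _ :=
  caratheodory_type (@lebesgue_outer R n).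

Definition lebesgue_rV : set lebesgueType -> \bar R := @lebesgue_outer R n.

HB.instance Definition _ := isMeasure.Build _ lebesgueType R lebesgue_rV
  (caratheodory_measure0 (@lebesgue_outer R n))
  (@caratheodory_measure_ge0 _ _ (@lebesgue_outer R n))
  (@caratheodory_measure_sigma_additive _ _ (@lebesgue_outer R n)).

End lebesgue_rV_instances.

Arguments lebesgue_rV R n : clear implicits.

(* Volume of the unit ball of R^k, by the recursion V_(k+2) = 2 pi / (k+2) V_k. *)
Fixpoint unit_ball_volume (R : realType) (k : nat) : R :=
  match k with
  | 0 => 1
  | 1 => 2
  | j.+2 => 2 * pi / j.+2%:R * unit_ball_volume R j
  end.

Definition diameter (R : realType) (n : nat) (A : set 'rV[R]_n) : \bar R :=
  ereal_sup [set (enorm (z.1 - z.2))%:E | z in A `*` A].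

(* k-dimensional size V_k (diam A / 2)^k, only used on sets of finite diameter;
   for k = 0 it is 1. *)
Definition hausdorff_size (R : realType) (n k : nat) (A : set 'rV[R]_n) :
    \bar R :=
  (unit_ball_volume R k * (fine (diameter A) / 2) ^+ k)%:E.

Definition hausdorff_delta (R : realType) (n k : nat) (delta : R) :
    set 'rV[R]_n -> \bar R :=
  cover_outer [set A : set 'rV[R]_n | A !=set0 /\ (diameter A <= delta%:E)%E]
    id (@hausdorff_size R n k).

(* k-dimensional Hausdorff outer measure on R^n, with the normalization for which
   H^n is the Lebesgue measure on R^n. *)
Definition hausdorff_outer (R : realType) (n k : nat) (A : set 'rV[R]_n) : \bar R :=
  ereal_sup [set hausdorff_delta k delta A | delta in [set delta : R | 0 < delta]].

Section hausdorff_instances.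
Context (R : realType) (n k : nat).
Local Open Scope ereal_scope.

Lemma unit_ball_volume_ge0 j :
  (0 <= unit_ball_volume R j)%R /\ (0 <= unit_ball_volume R j.+1)%R.
Proof.
elim: j => [|j [IH1 IH2]]; first by rewrite /= ler01 ler0n.
by split => //=; rewrite !mulr_ge0// ?pi_ge0.
Qed.

Lemma hausdorff_size_ge0 delta (A : set 'rV[R]_n) :
  A !=set0 /\ diameter A <= delta%:E -> 0 <= hausdorff_size k A.
Proof.
move=> [[x Ax] _]; rewrite lee_fin mulr_ge0 ?(unit_ball_volume_ge0 k).1//.
rewrite exprn_ge0// divr_ge0// fine_ge0//.
apply: (@le_trans _ _ (enorm (x - x))%:E); first by rewrite lee_fin sqrtr_ge0.
by apply: ereal_sup_ubound; exists (x, x).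
Qed.

Lemma hausdorff0 : hausdorff_outer k (set0 : set 'rV[R]_n) = 0.
Proof.
rewrite /hausdorff_outer (_ : [set _ | _ in _] = [set 0]) ?ereal_sup1//.
apply/seteqP; split => [_ [d _ <-]|_ ->].
  exact: (cover_outer0 _ (@hausdorff_size_ge0 d)).
by exists 1%R => /=; [exact: ltr01 |
  exact: (cover_outer0 _ (@hausdorff_size_ge0 1))].
Qed.

Lemma hausdorff_ge0 (A : set 'rV[R]_n) : 0 <= hausdorff_outer k A.
Proof.
apply: (@le_trans _ _ (hausdorff_delta k 1 A)).
  exact: (cover_outer_ge0 _ (@hausdorff_size_ge0 1)).
by apply: ereal_sup_ubound; exists 1%R => //=; exact: ltr01.
Qed.

Lemma le_hausdorff (A B : set 'rV[R]_n) : A `<=` B -> hausdorff_outer k A <= hausdorff_outer k B.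
Proof.
move=> AB; apply: ge_ereal_sup => _ [d d0 <-].
apply: (@le_trans _ _ (hausdorff_delta k d B)); first exact: le_cover_outer.
by apply: ereal_sup_ubound; exists d.
Qed.

Lemma hausdorff_sigma_subadditive : sigma_subadditive (@hausdorff_outer R n k).
Proof.
move=> F; apply: ge_ereal_sup => _ [d d0 <-].
apply: le_trans (cover_outer_sigma_subadditive _ (@hausdorff_size_ge0 d) F) _.
apply: lee_nneseries => i _.
  by move=> _; exact: (cover_outer_ge0 _ (@hausdorff_size_ge0 d)).
by apply: ereal_sup_ubound; exists d.
Qed.

HB.instance Definition _ := isOuterMeasure.Build R 'rV[R]_n (@hausdorff_outer R n k)
  hausdorff0 hausdorff_ge0 le_hausdorff hausdorff_sigma_subadditive.

Definition hausdorffType : measurableType _ :=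
  caratheodory_type (@hausdorff_outer R n k).

Definition hausdorff : set hausdorffType -> \bar R := @hausdorff_outer R n k.

HB.instance Definition _ := isMeasure.Build _ hausdorffType R hausdorff
  (caratheodory_measure0 (@hausdorff_outer R n k))
  (@caratheodory_measure_ge0 _ _ (@hausdorff_outer R n k))
  (@caratheodory_measure_sigma_additive _ _ (@hausdorff_outer R n k)).

End hausdorff_instances.

Arguments hausdorff R n k : clear implicits.

Section besov.
Context (R : realType) (N m : nat).
Implicit Types (q s r : R) (u : 'rV[R]_N -> 'rV[R]_m) (G Omega K : set 'rV[R]_N).
Local Open Scope ereal_scope.

(* A function on Omega is represented by a function on the whole space of which
   only the values on Omega are used. *)
Definition measurable_on Omega u := forall j : 'I_m,
  measurable_fun (Omega : set (lebesgueType R N)) (fun x => u x 0%R j).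

Definition Lq q u :=
  measurable_on setT u /\ finite_norm (lebesgue_rV R N) q%:E (fun x => enorm (u x)).

Definition Lq_loc q Omega u :=
  measurable_on Omega u /\
  forall K, compact K -> K `<=` Omega ->
    \int[lebesgue_rV R N]_(x in K) (enorm (u x) `^ q)%:E < +oo.

Definition besov q s u :=
  Lq q u /\
  ereal_sup [set ereal_sup
      [set \int[lebesgue_rV R N]_x
             (enorm (u (x + h)%R - u x) `^ q / rho `^ (s * q))%:E
        | h in [set h : 'rV[R]_N | (enorm h <= rho)%R]]
    | rho in [set rho : R | (0 < rho)%R]] < +oo.

Definition besov_loc q s Omega u :=
  Lq_loc q Omega u /\
  forall K, compact K -> K `<=` Omega ->
    exists2 uK : 'rV[R]_N -> 'rV[R]_m,
      besov q s uK & forall x, K x -> uK x = u x.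

Definition compactly_inside G Omega :=
  compact (closure G) /\ closure G `<=` Omega.

Definition sphere_energy q r u (eps : R) : \bar R :=
  \int[hausdorff R N N.-1]_(n in @unit_sphere R N)
    \int[lebesgue_rV R N]_x
      (enorm (u (x + eps *: n)%R - u x) `^ q / eps `^ r)%:E.

Definition sphere_energy_in G q r u (eps : R) : \bar R :=
  \int[hausdorff R N N.-1]_(n in @unit_sphere R N)
    \int[lebesgue_rV R N]_(x in G)
      (\1_G (x + eps *: n)%R *
        (enorm (u (x + eps *: n)%R - u x) `^ q / eps `^ r))%:E.

End besov.

(* Main.v *)
Require Import Defs.
From HB Require Import structures.
From mathcomp Require Import all_boot all_order all_algebra.
From mathcomp Require Import all_classical all_reals all_analysis measurable_realfun.
From mathcomp Require Import ring lra.

Set Implicit Arguments.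
Unset Strict Implicit.
Unset Printing Implicit Defensive.
Import Order.TTheory GRing.Theory Num.Theory.
Import numFieldNormedType.Exports.

Local Open Scope classical_set_scope.
Local Open Scope ring_scope.

(** Write phi(z) for the integral of |u(x + z) - u(x)|^q over x.  Membership in
    the Besov space says that phi(z) is O(|z|^r); the sphere energy at scale t is
    the integral of phi(t n) / t^r over unit vectors n.

    A pointwise bound on phi can be integrated over the sphere because the sphere
    has finite surface measure ([hausdorff_sphere_lty]), which gives one direction.

    Conversely a bound on the average over n says little about a given direction,
    since a single direction has surface measure zero in dimension at least two.
    What saves the argument is that phi is almost subadditive: phi(z + w) <= 2^q (phi(z) + phi(w)).  By
    Chebyshev the set B of directions n for which phi(t n) exceeds K t^r is small
    when K is large ([large_increment_sphere]), and a basis vector e_i is a sum of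
    at most four unit vectors avoiding any set of small surface measure
    ([sphere_decomposition]).  So phi(t e_i) is O(t^r), and splitting a vector
    along the axes bounds phi at every small vector ([increment_bound]); at large
    vectors the L^q norm of u bounds it.  Everything happens at a single scale t,
    so that no polar coordinates and no integration over t are involved.

    In dimension one the vector e_i itself avoids a small enough B.  In higher
    dimension its decomposition starts from a unit vector x at height s = x_i with
    0 <= s <= 1/2.  The sum of x and its mirror image in the axis i is 2 s e_i.
    Moving x along its meridian to the height 1/2 - s is a Lipschitz involution of
    this band of the sphere, and the same construction there gives
    2 (1/2 - s) e_i: the four vectors add up to e_i for every x.  Each of the four
    depends on x in a way that pulls sets of small measure back to sets of small
    measure, and the band has positive measure ([hausdorff_sphere_cap_gt0]), so
    some x makes all four avoid B.

    Two measurability questions arise on the sphere.  Sublevel sets of functions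
    that are Lipschitz for the Euclidean distance are measurable for the Hausdorff
    measure by Caratheodory's criterion ([hausdorff_caratheodory]).  The function
    phi is only controlled through phi(z) -> 0 as z -> 0, the continuity of
    translations in L^q ([Lq_shift_continuous]): it shows that phi is still large
    near a bad direction, which is enough for Chebyshev's inequality.

    For the local statement u is multiplied by a Lipschitz cutoff function eta
    that is 1 on the given compact set and supported well inside an open set G.
    The difference of eta u at distance t is bounded by that of u on G, plus a
    term of size t |u|, whose q-th power is O(t^r) because r <= q.  Hence eta u
    satisfies the global criterion ([besov_cutoff_mul]). *)

(** * The Euclidean norm *)

Section euclidean_norm.
Context (R : realType) (n : nat).
Implicit Types x y z : 'rV[R]_n.

Lemma sum_sqr_ge0 x : 0 <= \sum_(i < n) x 0 i ^+ 2.
Proof. by apply: sumr_ge0 => i _; exact: sqr_ge0. Qed.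

Lemma enorm_ge0 x : 0 <= enorm x. Proof. exact: sqrtr_ge0. Qed.

Lemma sqr_enorm x : enorm x ^+ 2 = \sum_(i < n) x 0 i ^+ 2.
Proof. by rewrite sqr_sqrtr// sum_sqr_ge0. Qed.

Lemma enorm_eq x y : \sum_i x 0 i ^+ 2 = \sum_i y 0 i ^+ 2 -> enorm x = enorm y.
Proof. by rewrite /enorm => ->. Qed.

Lemma enormZ a x : enorm (a *: x) = `|a| * enorm x.
Proof.
rewrite /enorm -sqrtr_sqr -sqrtrM ?sqr_ge0// mulr_sumr; congr Num.sqrt.
by apply: eq_bigr => i _; rewrite mxE exprMn.
Qed.

Lemma enormN x : enorm (- x) = enorm x.
Proof. by rewrite -scaleN1r enormZ normrN1 mul1r. Qed.

Lemma enorm0 : enorm (0 : 'rV[R]_n) = 0.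
Proof. by rewrite -(scale0r (0 : 'rV[R]_n)) enormZ normr0 mul0r. Qed.

Lemma coord_le_enorm x i : `|x 0 i| <= enorm x.
Proof.
rewrite -sqrtr_sqr ler_wsqrtr// (bigD1 i)//= lerDl sumr_ge0// => j _.
exact: sqr_ge0.
Qed.

(** Lagrange's identity: the defect is a sum of squares of 2 x 2 minors. *)
Lemma cauchy_schwarz x y :
  (\sum_i x 0 i * y 0 i) ^+ 2 <= (\sum_i x 0 i ^+ 2) * (\sum_i y 0 i ^+ 2).
Proof.
rewrite -subr_ge0 -(@pmulr_rge0 _ 2)//.
suff -> : 2 * ((\sum_i x 0 i ^+ 2) * (\sum_i y 0 i ^+ 2)
              - (\sum_i x 0 i * y 0 i) ^+ 2) =
    \sum_i \sum_j (x 0 i * y 0 j - x 0 j * y 0 i) ^+ 2.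
  by apply: sumr_ge0 => i _; apply: sumr_ge0 => j _; exact: sqr_ge0.
have E : \sum_i \sum_j (x 0 i * y 0 j - x 0 j * y 0 i) ^+ 2 =
    \sum_i \sum_j (x 0 i ^+ 2 * y 0 j ^+ 2) +
    \sum_i \sum_j (y 0 i ^+ 2 * x 0 j ^+ 2) -
    2 * \sum_i \sum_j (x 0 i * y 0 i) * (x 0 j * y 0 j).
  rewrite mulr_sumr -sumrN -!big_split/=; apply: eq_bigr => i _.
  rewrite mulr_sumr -sumrN -!big_split/=; apply: eq_bigr => j _; ring.
have S (a b : 'I_n -> R) : \sum_i \sum_j a i * b j = (\sum_i a i) * (\sum_j b j).
  by rewrite mulr_suml; apply: eq_bigr => i _; rewrite mulr_sumr.
by rewrite E !S; ring.
Qed.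

Lemma enormD x y : enorm (x + y) <= enorm x + enorm y.
Proof.
rewrite -(@ler_pXn2r _ 2) ?nnegrE ?addr_ge0 ?enorm_ge0//.
rewrite sqrrD !sqr_enorm.
rewrite (_ : \sum_i (x + y) 0 i ^+ 2 = \sum_i x 0 i ^+ 2 +
  (\sum_i x 0 i * y 0 i) *+ 2 + \sum_i y 0 i ^+ 2); last first.
  rewrite -sumrMnl -!big_split/=; apply: eq_bigr => i _; rewrite mxE; ring.
rewrite lerD2r lerD2l lerMn2r/=.
apply: (le_trans (ler_norm _)); rewrite -sqrtr_sqr /enorm -sqrtrM ?sum_sqr_ge0//.
by rewrite ler_wsqrtr// cauchy_schwarz.
Qed.

Lemma enormB x y : enorm (x - y) = enorm (y - x).
Proof. by rewrite -enormN opprB. Qed.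

Lemma enorm_triangle y x z : enorm (x - z) <= enorm (x - y) + enorm (y - z).
Proof. by apply: le_trans (enormD _ _); rewrite addrA subrK. Qed.

Lemma ler_enormB x y : `|enorm x - enorm y| <= enorm (x - y).
Proof.
rewrite ler_norml; apply/andP; split.
  by rewrite lerNl opprB lerBlDr enormB (le_trans _ (enormD _ _))// subrK.
by rewrite lerBlDr (le_trans _ (enormD _ _))// subrK.
Qed.

Lemma enorm_le_sum x : enorm x <= \sum_i `|x 0 i|.
Proof.
rewrite -(@ler_pXn2r _ 2) ?nnegrE ?enorm_ge0 ?sumr_ge0// sqr_enorm.
rewrite expr2 mulr_suml ler_sum// => i _.
rewrite -real_normK ?num_real// expr2 ler_wpM2l// (bigD1 i)//= lerDl.
exact: sumr_ge0.
Qed.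

Lemma enorm_le_norm x : enorm x <= n%:R * `|x|.
Proof.
apply: (le_trans (enorm_le_sum x)).
rewrite (le_trans (ler_sum _ (G := fun=> `|x|) _))//; last first.
  by rewrite sumr_const card_ord mulr_natl.
move=> i _; case: n x i => [x []//|n' x i].
by rewrite [leRHS]/Num.norm/= mx_normrE; apply: (le_bigmax _ _ (ord0, i)).
Qed.

End euclidean_norm.

Lemma norm_le_enorm (R : realType) (n : nat) (x : 'rV[R]_n) : `|x| <= enorm x.
Proof.
rewrite [leLHS]/Num.norm/= mx_normrE; apply: bigmax_le => [|[i j] _].
  exact: enorm_ge0.
by rewrite /= ord1; exact: coord_le_enorm.
Qed.

(** * Integrals of functions that need not be measurable *)

Section lower_integral.
Context d (T : measurableType d) (R : realType).
Variable mu : {measure set T -> \bar R}.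
Local Open Scope ereal_scope.
Implicit Types (D A : set T) (f g k : T -> \bar R).

Import HBNNSimple.

(** The integral of a nonnegative function is by definition a supremum over the
    simple functions below it, which makes it monotone on all functions. *)
Lemma ge0_le_integral_nonmeasurable D f k :
  (forall x, D x -> 0 <= f x) -> (forall x, D x -> f x <= k x) ->
  \int[mu]_(x in D) f x <= \int[mu]_(x in D) k x.
Proof.
move=> f0 fk; have k0 x : D x -> 0 <= k x.
  by move=> Dx; exact: le_trans (f0 x Dx) (fk x Dx).
rewrite !ge0_integralE//; apply: le_ereal_sup => _ [h hf <-]; exists h => // x.
apply: le_trans (hf x) _; rewrite /patch; case: ifPn => //.
by rewrite inE => /fk.
Qed.

Lemma ge0_integral_mul_set D A f (c : R) : measurable A -> A `<=` D -> (0 <= c)%R ->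
  (forall x, D x -> 0 <= f x) -> (forall x, A x -> c%:E <= f x) ->
  c%:E * mu A <= \int[mu]_(x in D) f x.
Proof.
move=> mA AD c0 f0 cf.
apply: (@le_trans _ _ (\int[mu]_(x in A) cst c%:E x)).
  by rewrite integral_cst.
rewrite integral_mkcond [leRHS]integral_mkcond.
apply: ge0_le_integral_nonmeasurable => x _; rewrite /patch/=.
  by case: ifPn => // _; rewrite lee_fin.
case: ifPn => [|_]; first by rewrite inE => Ax; rewrite mem_set ?cf//; exact: AD.
by case: ifPn => //; rewrite inE => /f0.
Qed.

Lemma ge0_integral_le_scale D f k (c : R) : (0 < c)%R ->
  (forall x, D x -> 0 <= k x) -> (forall x, D x -> 0 <= f x) ->
  (forall x, D x -> k x <= c%:E * f x) ->
  \int[mu]_(x in D) k x <= c%:E * \int[mu]_(x in D) f x.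
Proof.
move=> c0 k0 f0 kcf.
apply: le_trans (ge0_le_integral_nonmeasurable k0 kcf) _.
have cf0 x : D x -> 0 <= c%:E * f x by move=> Dx; rewrite mule_ge0 ?f0 ?lee_fin ?ltW.
rewrite !ge0_integralE//; apply: ge_ereal_sup => _ [h hf <-].
have c'0 : (0 <= c^-1)%R by rewrite invr_ge0 ltW.
suff H : sintegral mu (scale_nnsfun h c'0) <=
    ereal_sup [set sintegral mu h0 | h0 in
      [set h0 : {nnsfun T >-> R} | forall x, (h0 x)%:E <= (f \_ D) x]].
  rewrite -(@lee_pdivrMl _ c)//; apply: le_trans H.
  by rewrite sintegralrM.
apply: ereal_sup_ubound; exists (scale_nnsfun h c'0) => // x /=.
have := hf x; rewrite /patch; case: ifPn => [xD|_] hx.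
  by rewrite EFinM lee_pdivrMl.
rewrite lee_fin pmulr_rle0 ?invr_gt0//; move: hx; by rewrite lee_fin.
Qed.

(** The integral of a possibly non-measurable function is a supremum over the
    simple functions below it, hence only superadditive in general.  If h <= f + g
    is simple and g is measurable, then (h - g)^+ is measurable and below f: one
    measurable summand is enough for subadditivity. *)
Lemma ge0_integral_le_add D f k (g : T -> R) : measurable D ->
  measurable_fun D g -> (forall x, D x -> (0 <= g x)%R) ->
  (forall x, D x -> 0 <= f x) -> (forall x, D x -> 0 <= k x) ->
  (forall x, D x -> k x <= f x + (g x)%:E) ->
  \int[mu]_(x in D) k x <= \int[mu]_(x in D) f x + \int[mu]_(x in D) (g x)%:E.
Proof.
move=> mD mg g0 f0 k0 kfg; rewrite (ge0_integralE _ k0).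
apply: ge_ereal_sup => _ [h hk <-].
pose j x := Num.max 0%R (h x - g x)%R.
have mj : measurable_fun D j.
  apply: measurable_maxr => //; apply: measurable_funB => //.
  exact: measurable_funTS.
apply: (@le_trans _ _ (\int[mu]_(x in D) ((j x)%:E + (g x)%:E))).
  rewrite -integralT_nnsfun [leRHS]integral_mkcond.
  apply: ge0_le_integral_nonmeasurable => x _; first by rewrite lee_fin.
  have := hk x; rewrite /patch; case: ifPn => // _ _.
  by rewrite -EFinD lee_fin -lerBlDr /j le_max lexx orbT.
rewrite ge0_integralD//; last first.
- exact/measurable_EFinP.
- exact/measurable_EFinP.
- by move=> x Dx; rewrite lee_fin le_max lexx.
apply: leeD => //; apply: ge0_le_integral_nonmeasurable => x Dx.
  by rewrite lee_fin le_max lexx.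
rewrite /j; have [_|_] := leP (h x - g x)%R 0%R; first exact: f0.
rewrite EFinB leeBlDr//; apply: le_trans (kfg x Dx).
by have := hk x; rewrite /patch mem_set.
Qed.

End lower_integral.

(** * Covers and Hausdorff measure *)

Section hausdorff_cover.
Context (R : realType).
Local Open Scope ereal_scope.

Lemma cover_outer_le_cover (T I : Type) (P : set I) (S : I -> set T)
    (g : I -> \bar R) (A : set T) (F : nat -> option I) :
  (forall k i, F k = Some i -> P i) -> A `<=` \bigcup_k oapp S set0 (F k) ->
  cover_outer P S g A <= \sum_(k <oo) oapp g 0 (F k).
Proof. by move=> PF AF; apply: ereal_inf_lbound; exists F. Qed.

Lemma le_diameter (n : nat) (A : set 'rV[R]_n) x y : A x -> A y ->
  (enorm (x - y))%:E <= diameter A.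
Proof. by move=> Ax Ay; apply: ereal_sup_ubound; exists (x, y). Qed.

Lemma diameter_le (n : nat) (A : set 'rV[R]_n) (d : R) :
  (forall x y, A x -> A y -> (enorm (x - y) <= d)%R) -> diameter A <= d%:E.
Proof.
by move=> Ad; apply: ge_ereal_sup => _ [[x y] [/= Ax Ay] <-]; rewrite lee_fin Ad.
Qed.

Lemma diameter_ge0 (n : nat) (A : set 'rV[R]_n) : A !=set0 -> 0 <= diameter A.
Proof.
by move=> [x Ax]; rewrite (le_trans _ (le_diameter Ax Ax))// lee_fin enorm_ge0.
Qed.

Lemma fine_diameterK (n : nat) (A : set 'rV[R]_n) (d : R) : A !=set0 ->
  diameter A <= d%:E -> (fine (diameter A))%:E = diameter A.
Proof.
move=> A0 Ad; rewrite fineK// ge0_fin_numE ?diameter_ge0//.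
exact: le_lt_trans (ltry d).
Qed.

Lemma enorm_le_diameter (n : nat) (A : set 'rV[R]_n) (d : R) x y :
  diameter A <= d%:E -> A x -> A y -> (enorm (x - y) <= fine (diameter A))%R.
Proof.
move=> Ad Ax Ay; rewrite -lee_fin (fine_diameterK _ Ad); last by exists x.
exact: le_diameter.
Qed.

Lemma hausdorff_size_le (n k : nat) (A : set 'rV[R]_n) (d : R) : A !=set0 ->
  (forall x y, A x -> A y -> (enorm (x - y) <= d)%R) ->
  hausdorff_size k A <= (unit_ball_volume R k * (d / 2) ^+ k)%:E.
Proof.
move=> A0 /diameter_le Ad; rewrite lee_fin ler_wpM2l ?(unit_ball_volume_ge0 R k).1//.
rewrite lerXn2r// ?nnegrE ?divr_ge0// ?fine_ge0 ?diameter_ge0//.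
  by rewrite -lee_fin (le_trans _ Ad)// diameter_ge0.
by rewrite ler_pM2r// -lee_fin (fine_diameterK _ Ad).
Qed.

Lemma hausdorff_delta_le (n k : nat) (delta : R) (A : set 'rV[R]_n) :
  (0 < delta)%R -> hausdorff_delta k delta A <= hausdorff_outer k A.
Proof. by move=> d0; apply: ereal_sup_ubound; exists delta. Qed.

Lemma hausdorff_delta_ge0 (n k : nat) (delta : R) (A : set 'rV[R]_n) :
  0 <= hausdorff_delta k delta A.
Proof. exact: (cover_outer_ge0 _ (@hausdorff_size_ge0 R n k delta)). Qed.

Lemma le_hausdorff_delta (n k : nat) (d1 d2 : R) (A : set 'rV[R]_n) :
  (d1 <= d2)%R -> hausdorff_delta k d2 A <= hausdorff_delta k d1 A.
Proof.
move=> d12; apply: le_ereal_inf_tmp => _ [F [PF AF] <-].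
apply: cover_outer_le_cover => // i S /PF[S0 Sd]; split=> //.
by rewrite (le_trans Sd)// lee_fin.
Qed.

Lemma oapp_hausdorff_size_ge0 (n k : nat) (delta : R)
    (F : nat -> option (set 'rV[R]_n)) :
  (forall i S, F i = Some S -> S !=set0 /\ diameter S <= delta%:E) ->
  forall i, 0 <= oapp (hausdorff_size k) 0 (F i).
Proof.
by move=> PF i; case E : (F i) => [S|]//=; exact: hausdorff_size_ge0 (PF _ _ E).
Qed.

(** Covering sets are first cut down to A, where f is Lipschitz; those that miss A
    are dropped, because covers consist of nonempty sets. *)
Lemma hausdorff_lipschitz_image (n p k : nat) (L : R) (A : set 'rV[R]_n)
    (B : set 'rV[R]_p) (f : 'rV[R]_n -> 'rV[R]_p) : (0 < L)%R ->
  (forall x y, A x -> A y -> (enorm (f x - f y) <= L * enorm (x - y))%R) ->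
  B `<=` f @` A -> hausdorff_outer k B <= (L ^+ k)%:E * hausdorff_outer k A.
Proof.
move=> L0 fL BfA; apply: ge_ereal_sup => _ [d /= d0 <-].
have Lk0 : (0 < L ^+ k)%R by rewrite exprn_gt0.
have dL0 : (0 < d / L)%R by rewrite divr_gt0.
suff H : hausdorff_delta k d B <= (L ^+ k)%:E * hausdorff_delta k (d / L) A.
  by apply: le_trans H _; rewrite lee_pmul2l// hausdorff_delta_le.
rewrite -lee_pdivrMl//; apply: le_ereal_inf_tmp => _ [F [PF AF] <-].
rewrite lee_pdivrMl//.
pose fS S := f @` (S `&` A).
pose G i := if F i is Some U then
  if pselect ((U `&` A) !=set0) then Some (fS U) else None else None.
have fSd S x y : S !=set0 /\ diameter S <= (d / L)%:E -> fS S x -> fS S y ->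
    (enorm (x - y) <= L * fine (diameter S))%R.
  move=> [S0 Sd] [{}x [Sx Ax] <-] [{}y [Sy Ay] <-].
  apply: (le_trans (fL _ _ Ax Ay)); rewrite ler_pM2l//.
  exact: enorm_le_diameter Sd Sx Sy.
have PG i S : G i = Some S -> S !=set0 /\ diameter S <= d%:E.
  rewrite /G; case E : (F i) => [S'|]//; case: pselect => // -[x S'x] [<-].
  split; first by exists (f x); exists x.
  have S'd := PF _ _ E; apply: diameter_le => u v fu fv.
  apply: (le_trans (fSd _ _ _ S'd fu fv)).
  by rewrite -ler_pdivlMl// mulrC -lee_fin (fine_diameterK S'd.1 S'd.2) S'd.2.
apply: (@le_trans _ _ (\sum_(i <oo) oapp (hausdorff_size k) 0 (G i))).
  apply: cover_outer_le_cover => // y By.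
  have [x Ax <-] := BfA _ By; have [i _ Fx] := AF _ Ax; exists i => //.
  rewrite /G; case: (F i) Fx => [S|]//= Sx.
  by case: pselect => [_|[]] /=; [exists x|exists x].
rewrite -nneseriesZl//; last by move=> i _; exact: oapp_hausdorff_size_ge0 PF i.
apply: lee_nneseries => [i _ _|i _]; first exact: oapp_hausdorff_size_ge0 PG i.
rewrite /G; case E : (F i) => [S|]//=; last by rewrite mule0.
have S'd := PF _ _ E; case: pselect => [|_]/=; last first.
  by rewrite mule_ge0 ?lee_fin ?(ltW Lk0)//; exact: (hausdorff_size_ge0 k S'd).
move=> [x Sx]; apply: le_trans (hausdorff_size_le _ _ (fun x y => fSd S x y S'd)) _.
  by exists (f x); exists x.
by rewrite -EFinM lee_fin mulrCA -exprMn mulrA.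
Qed.

End hausdorff_cover.

(** * Caratheodory's criterion for the Hausdorff measure *)

Section hausdorff_measurable.
Context (R : realType) (n k : nat).
Local Notation H := (@hausdorff_outer R n k).
Local Open Scope ereal_scope.
Implicit Types (A B X : set 'rV[R]_n) (g : 'rV[R]_n -> R).

(** Below the separation distance each covering set meets at most one of the two
    pieces, so that a cover splits in two. *)
Lemma hausdorff_delta_separated A B (eta delta : R) : (delta < eta)%R ->
  (forall x y, A x -> B y -> (eta <= enorm (x - y))%R) ->
  hausdorff_delta k delta A + hausdorff_delta k delta B <=
  hausdorff_delta k delta (A `|` B).
Proof.
move=> de ABe; apply: le_ereal_inf_tmp => _ [F [PF ABF] <-].
pose meetsA U := `[< (U `&` A) !=set0 >].
pose FA i := if F i is Some U then if meetsA U then Some U else None else None.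
pose FB i := if F i is Some U then if meetsA U then None else Some U else None.
have PFA i U : FA i = Some U -> U !=set0 /\ diameter U <= delta%:E.
  rewrite /FA; case E : (F i) => [V|]//; case: (meetsA V) => // -[<-].
  exact: PF E.
have PFB i U : FB i = Some U -> U !=set0 /\ diameter U <= delta%:E.
  rewrite /FB; case E : (F i) => [V|]//; case: (meetsA V) => // -[<-].
  exact: PF E.
have -> : \sum_(i <oo) oapp (hausdorff_size k) 0 (F i) =
    \sum_(i <oo) oapp (hausdorff_size k) 0 (FA i) +
    \sum_(i <oo) oapp (hausdorff_size k) 0 (FB i).
  rewrite -nneseriesD; last 2 first.
  - by move=> i _ _; exact: oapp_hausdorff_size_ge0 PFA i.
  - by move=> i _ _; exact: oapp_hausdorff_size_ge0 PFB i.
  apply: eq_eseriesr => i _; rewrite /FA /FB; case: (F i) => [U|]/=.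
    by case: (meetsA U); rewrite /= ?adde0 ?add0e.
  by rewrite adde0.
apply: leeD; apply: cover_outer_le_cover => // x Zx.
  have [i _ Fx] := ABF _ (or_introl Zx); exists i => //.
  rewrite /FA; case: (F i) Fx => [U|]//= Ux.
  by rewrite (_ : meetsA U)//; apply/asboolP; exists x.
have [i _ Fx] := ABF _ (or_intror Zx); exists i => //.
rewrite /FB; case E : (F i) Fx => [U|]//= Ux.
case: ifPn => //= /asboolP[y [Uy Ay]].
have [_ Ud] := PF _ _ E.
have := le_trans (le_diameter Uy Ux) Ud; rewrite lee_fin => yxd.
by have := le_trans (ABe _ _ Ay Zx) yxd; rewrite leNgt de.
Qed.

Lemma hausdorff_separated A B (eta : R) : (0 < eta)%R ->
  (forall x y, A x -> B y -> (eta <= enorm (x - y))%R) ->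
  H A + H B <= H (A `|` B).
Proof.
move=> e0 ABe.
have [->|ABfin] := eqVneq (H (A `|` B)) +oo; first exact: leey.
have HABf : H (A `|` B) \is a fin_num.
  by rewrite ge0_fin_numE ?hausdorff_ge0// ltey.
have fin C : C `<=` A `|` B -> H C \is a fin_num.
  move=> CAB; rewrite ge0_fin_numE ?hausdorff_ge0//.
  by rewrite (le_lt_trans (le_hausdorff k CAB))// ltey.
have key (d1 d2 : R) : (0 < d1)%R -> (0 < d2)%R ->
    hausdorff_delta k d1 A + hausdorff_delta k d2 B <= H (A `|` B).
  move=> d10 d20; pose d := (Num.min (eta / 2) (Num.min d1 d2))%R.
  have d0 : (0 < d)%R by rewrite !lt_min d10 d20 divr_gt0.
  have de : (d < eta)%R.
    by rewrite gt_min (_ : eta / 2 < eta)%R// gtr_pMr// invf_lt1 ?ltr1n.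
  apply: le_trans (hausdorff_delta_le _ _ d0).
  apply: le_trans (hausdorff_delta_separated de ABe).
  by apply: leeD; apply: le_hausdorff_delta; rewrite !ge_min lexx ?orbT.
rewrite -leeBrDr ?fin//; apply: ge_ereal_sup => _ [d1 /= d10 <-].
have dAf : hausdorff_delta k d1 A \is a fin_num.
  rewrite ge0_fin_numE ?hausdorff_delta_ge0//.
  apply: le_lt_trans (hausdorff_delta_le _ _ d10) _.
  by rewrite -ge0_fin_numE ?hausdorff_ge0 ?fin.
rewrite leeBrDr ?fin// addeC -leeBrDr//; apply: ge_ereal_sup => _ [d2 /= d20 <-].
by rewrite leeBrDr// addeC key.
Qed.

(** Caratheodory's criterion.  The layers of X on which g is close to 1/l are
    separated from each other when l runs over numbers of the same parity, so that
    the sum of their measures converges; hence the part of X on which g is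
    positive has the measure of {g >= 1/l} in the limit, and that part is separated
    from {g <= 0}. *)
Lemma hausdorff_caratheodory g :
  (forall x y, (g x - g y <= enorm (x - y))%R) ->
  (@hausdorff_outer R n k).-caratheodory [set x | (g x <= 0)%R].
Proof.
move=> gL; apply: le_caratheodory_measurable => X.
set Z := [set x | _].
change (H (X `&` Z) + H (X `&` ~` Z) <= H X).
have [->|Xoo] := eqVneq (H X) +oo; first exact: leey.
have Xfin : H X \is a fin_num by rewrite ge0_fin_numE ?hausdorff_ge0// ltey.
pose c l : R := (l.+1%:R^-1)%R.
have c0 l : (0 < c l)%R by rewrite invr_gt0.
have cS l m : (l < m)%N -> (c m < c l)%R.
  by move=> lm; rewrite ltf_pV2 ?posrE// ltr_nat ltnS.
have cle l m : (l <= m)%N -> (c m <= c l)%R.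
  by move=> lm; rewrite lef_pV2 ?posrE// ler_nat ltnS.
pose Y l := X `&` [set x | (c l <= g x)%R].
pose D l := X `&` [set x | (c l.+1 <= g x < c l)%R].
have sepg A B (a b : R) : (b < a)%R -> (forall x, A x -> (a <= g x)%R) ->
    (forall y, B y -> (g y <= b)%R) -> H A + H B <= H (A `|` B).
  move=> ba Aa Bb; apply: (@hausdorff_separated _ _ (a - b)%R).
    by rewrite subr_gt0.
  by move=> x y /Aa Ax /Bb By; apply: le_trans (gL x y); exact: lerB.
have layers (e : nat -> nat) : (forall l, ((e l).+2 <= e l.+1)%N) -> forall l,
    \sum_(i < l) H (D (e i)) <= H (\big[setU/set0]_(i < l) D (e i)).
  move=> e2; elim=> [|l IH]; first by rewrite !big_ord0; exact: hausdorff_ge0.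
  rewrite !big_ord_recr/=.
  apply: le_trans (leeD IH (lexx _)) _.
  case: l IH => [|l] IH.
    by rewrite !big_ord0 set0U hausdorff0 add0e.
  apply: (@sepg _ _ (c (e l).+1) (c (e l.+1))); first by rewrite cS ?e2.
    rewrite -(bigcup_mkord _ (fun i => D (e i))) => x [i /= il [_ /andP[+ _]]].
    apply: le_trans; apply: cle.
    have {}il : (i <= l)%N := il.
    rewrite ltnS; clear -e2 il; elim: l il => [|l IH].
      by rewrite leqn0 => /eqP->.
    rewrite leq_eqVlt => /predU1P[->//|/IH] il.
    by apply: leq_trans il _; apply: leq_trans (e2 l); rewrite ltnW.
  by move=> x [_ /andP[_ /ltW]].
have sumX (e : nat -> nat) : (forall l, ((e l).+2 <= e l.+1)%N) ->
    \sum_(i <oo) H (D (e i)) <= H X.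
  move=> e2; apply: lime_le.
    by apply: is_cvg_nneseries => i _ _; exact: hausdorff_ge0.
  near=> l; rewrite big_mkord; apply: le_trans (layers e e2 l) _.
  by apply: le_hausdorff; rewrite -(bigcup_mkord _ (fun i => D (e i))) => x [i _ []].
have sumfin : \sum_(i <oo) H (D i) < +oo.
  apply: (@le_lt_trans _ _ (H X + H X)); last by rewrite lte_add_pinfty ?ltey.
  apply: lime_le; first by apply: is_cvg_nneseries => i _ _; exact: hausdorff_ge0.
  near=> l; rewrite big_mkord.
  have e0 j : ((j.*2).+2 <= j.+1.*2)%N by rewrite doubleS.
  have e1 j : ((j.*2.+1).+2 <= j.+1.*2.+1)%N by rewrite doubleS.
  apply: le_trans (leeD (sumX (fun j => j.*2) e0) (sumX (fun j => j.*2.+1) e1)).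
  apply: (@le_trans _ _ (\sum_(0 <= i < l) H (D i.*2) + \sum_(0 <= i < l) H (D i.*2.+1))).
    rewrite -big_split/= -(big_mkord xpredT (fun i => H (D i))).
    apply: (@le_trans _ _ (\sum_(0 <= i < l.*2) H (D i))).
      rewrite [leRHS](@big_cat_nat _ _ _ l)//= -?addnn ?leq_addr//.
      by rewrite leeDl// sume_ge0// => i _; exact: hausdorff_ge0.
    elim: {+}l => [|j IH]; first by rewrite !big_geq.
    rewrite doubleS !big_nat_recr//= -addeA; exact: leeD.
  by apply: leeD; apply: nneseries_lim_ge => i _ _; exact: hausdorff_ge0.
have tail := nneseries_tail_cvg sumfin (fun i _ => hausdorff_ge0 k (D i)).
have Ytail l : H (X `&` ~` Z) <= H (Y l) + \sum_(l <= i <oo) H (D i).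
  pose F i := if (i < l)%N then set0 else D i.
  apply: (@le_trans _ _ (H (Y l `|` \bigcup_i F i))).
    apply: le_hausdorff => x [Xx /= /negP]; rewrite -ltNge => gx.
    have [cl|lc] := leP (c l) (g x); [by left|right].
    have exP : exists j, (c j <= g x)%R.
      have [j _ /(_ j (leqnn j))/ltW] := near_infty_natSinv_lt (PosNum gx).
      by exists j.
    have [] := ex_minnP exP; case=> [|j] cj jmin.
      by move: lc; rewrite ltNge (le_trans _ cj)// cle.
    have gcj : (g x < c j)%R.
      by rewrite ltNge; apply/negP => /jmin; rewrite ltnn.
    exists j => //; rewrite /F ifF; last first.
      apply/negbTE; rewrite -leqNgt; have [//|jl] := leqP l j.
      by move: lc; rewrite ltNge (le_trans _ cj)// cle.
    by split => //=; rewrite cj.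
  apply: le_trans (outer_measureU2 _ _ _) _; apply: leeD => //.
  apply: le_trans (outer_measure_sigma_subadditive _ _) _.
  rewrite (@nneseries_split _ _ 0 l); last by move=> i _; exact: hausdorff_ge0.
  rewrite add0n big_nat big1 ?add0e; last first.
    by move=> i /andP[_ il]; rewrite /F il; exact: hausdorff0.
  apply: lee_nneseries => [i _ _|i _]; first exact: hausdorff_ge0.
  by rewrite /F; case: ifPn => // _; rewrite outer_measure0; exact: hausdorff_ge0.
have sepZ l : H (X `&` Z) + H (Y l) <= H X.
  have : H (Y l) + H (X `&` Z) <= H (Y l `|` X `&` Z).
    by apply: (@sepg _ _ (c l) 0%R) => // x [].
  rewrite addeC => /le_trans; apply; apply: le_hausdorff.
  by move=> x [[]|[]].
have XZf : H (X `&` Z) \is a fin_num.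
  rewrite ge0_fin_numE ?hausdorff_ge0// (le_lt_trans _ (_ : H X < +oo)) ?ltey//.
  by apply: le_hausdorff => x [].
rewrite addeC -leeBrDr//; apply/lee_addgt0Pr => e e0.
have : \forall l \near \oo, \sum_(l <= i <oo) H (D i) < e%:E.
  by apply: (tail [set y | y < e%:E]); apply: (@open_ereal_lt' _ 0 e%:E); rewrite lte_fin.
case=> l _ /(_ l (leqnn l))/= tl.
apply: le_trans (Ytail l) _; apply: leeD; last exact: ltW.
by rewrite leeBrDr// addeC.
Unshelve. all: by end_near. Qed.

End hausdorff_measurable.

(** * The surface measure of the sphere and of its caps *)

Section finite_covers.
Context (R : realType).
Local Open Scope ereal_scope.

Lemma cover_outer_le_card (T J : Type) (I : finType) (P : set J) (S : J -> set T)
    (g : J -> \bar R) (A : set T) (c : I -> option J) (b : R) :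
  (forall j, P j -> 0 <= g j) ->
  (forall i j, c i = Some j -> P j) ->
  A `<=` [set x | exists i, oapp S set0 (c i) x] ->
  (forall i, oapp g 0 (c i) <= b%:E) ->
  cover_outer P S g A <= (#|I|%:R * b)%:E.
Proof.
move=> g0 cP Ac cb.
pose F m : option J := if insub m is Some o then c (enum_val (o : 'I_#|I|)) else None.
have PF m j : F m = Some j -> P j by rewrite /F; case: insub => // o /cP.
apply: le_trans (@cover_outer_le_cover _ _ _ P S g A F PF _) _.
  move=> x /Ac[i cx]; exists (enum_rank i) => //.
  by rewrite /F valK enum_rankK.
have F0 m : 0 <= oapp g 0 (F m) by case E : (F m) => [j|]//=; apply/g0/PF/E.
rewrite (@nneseries_split _ _ 0 #|I|)//= add0n.
rewrite [X in _ + X]eseries0 ?adde0; last first.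
  by move=> m Im _; rewrite /F insubF// ltnNge Im.
rewrite big_mkord; apply: le_trans (lee_sum (g := fun=> b%:E) _ _) _.
  by move=> o _; rewrite /F valK.
by rewrite sumEFin sumr_const card_ord mulr_natl.
Qed.

End finite_covers.

Section sphere_measure.
Context (R : realType) (k : nat).
Local Open Scope ereal_scope.
Local Notation sphere := (@unit_sphere R k.+1).

Lemma unit_ball_volume_gt0 j :
  (0 < unit_ball_volume R j)%R /\ (0 < unit_ball_volume R j.+1)%R.
Proof.
elim: j => [|j [IH1 IH2]]; first by rewrite /= ltr01 ltr0n.
by split => //=; rewrite !mulr_gt0// ?pi_gt0.
Qed.

(** Where the coordinate j has a fixed sign and modulus at least 1 / (k + 1), it is
    a Lipschitz function of the k others: x_j^2 - y_j^2 is controlled by them, and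
    x_j + y_j is bounded away from 0. *)
Lemma sphere_coord_lipschitz (j : 'I_k.+1) (s : bool) (e : R) x y :
  sphere x -> sphere y -> (k.+1%:R^-1 <= (-1) ^+ s * x 0 j)%R ->
  (k.+1%:R^-1 <= (-1) ^+ s * y 0 j)%R ->
  (forall l, `|x 0 (lift j l) - y 0 (lift j l)| <= e)%R ->
  (enorm (x - y) <= (k * k.+2)%:R * e)%R.
Proof.
move=> Sx Sy xj yj xye.
have coord1 z (l : 'I_k.+1) : sphere z -> (`|z 0 l| <= 1)%R.
  by move=> <-; exact: coord_le_enorm.
have sq z : sphere z -> (z 0 j ^+ 2 = 1 - \sum_l z 0 (lift j l) ^+ 2)%R.
  move=> Sz; have := sqr_enorm z; rewrite Sz expr1n (bigD1_ord j)//= => ->.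
  by rewrite addrK.
have xyj : (`|x 0 j - y 0 j| <= (k * k.+1)%:R * e)%R.
  have D2 : (`|x 0 j ^+ 2 - y 0 j ^+ 2| <= k%:R * (2 * e))%R.
    rewrite !sq// (_ : _ - _ = \sum_l (y 0 (lift j l) ^+ 2 - x 0 (lift j l) ^+ 2))%R.
      apply: le_trans (ler_norm_sum _ _ _) _.
      apply: le_trans (ler_sum _ (G := fun=> (2 * e)%R) _) _; last first.
        by rewrite sumr_const card_ord -[leLHS]mulr_natl.
      move=> l _; rewrite subr_sqr normrM mulrC ler_pM//.
        apply: le_trans (ler_normD _ _) _.
        by rewrite (_ : 2 = 1 + 1)%R// lerD// coord1.
      by rewrite distrC.
    by rewrite sumrB; ring.
  have D1 : (2 * k.+1%:R^-1 <= `|x 0 j + y 0 j|)%R.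
    apply: (@le_trans _ _ ((-1) ^+ s * (x 0 j + y 0 j))%R).
      by rewrite mulrDr mulr_natl mulr2n lerD.
    by apply: (le_trans (ler_norm _)); rewrite normrM normr_sign mul1r.
  have : (`|x 0 j - y 0 j| * (2 * k.+1%:R^-1) <= k%:R * (2 * e))%R.
    by apply: le_trans D2; rewrite subr_sqr normrM ler_wpM2l.
  have k1 : (0 < k.+1%:R^-1 :> R)%R by rewrite invr_gt0.
  rewrite (_ : k%:R * (2 * e) = ((k * k.+1)%:R * e) * (2 * k.+1%:R^-1))%R.
    by rewrite ler_pM2r// mulr_gt0.
  have : (k.+1%:R != 0 :> R)%R by rewrite pnatr_eq0.
  by rewrite natrM; move: (k.+1%:R)%R => z z0; field.
apply: (le_trans (enorm_le_sum _)); rewrite (bigD1_ord j)//=.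
rewrite (_ : (k * k.+2)%:R * e = (k * k.+1)%:R * e + k%:R * e)%R; last first.
  by rewrite -mulrDl -natrD mulnS addnC.
apply: lerD; first by rewrite !mxE.
apply: le_trans (ler_sum _ (G := fun=> e) _) _; last first.
  by rewrite sumr_const card_ord mulr_natl.
by move=> l _; rewrite !mxE.
Qed.

(** Otherwise the Euclidean norm, which is at most the sum of the moduli of the
    k + 1 coordinates, would be less than 1. *)
Lemma sphere_large_coord x : sphere x ->
  exists (j : 'I_k.+1) (s : bool), (k.+1%:R^-1 <= (-1) ^+ s * x 0 j)%R.
Proof.
move=> Sx; have /existsP[j jx] : [exists j, k.+1%:R^-1 <= `|x 0 j|]%R.
  apply: contraPT (Sx) => /existsPn/= xs; apply/eqP; rewrite lt_eqF//.
  apply: le_lt_trans (enorm_le_sum _) _.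
  rewrite (_ : 1 = \sum_(i < k.+1) k.+1%:R^-1)%R.
    apply: ltr_sum => [|j _]; rewrite ?ltNge ?xs//.
    by apply/hasP; exists ord0; rewrite ?mem_index_enum.
  by rewrite sumr_const card_ord -[RHS]mulr_natl divff// pnatr_eq0.
exists j, (x 0 j < 0)%R; move: jx; case: ltrP => x0.
  by rewrite ltr0_norm// expr1 mulN1r.
by rewrite ger0_norm// expr0 mul1r.
Qed.

(** Choosing a large coordinate, its sign, and a cell of a grid of step 2 / M for
    the k others cuts the sphere into 2 (k + 1) (M + 1)^k cells of diameter O(1/M):
    the sum of the k-th powers of the diameters is bounded independently of M. *)
Lemma hausdorff_sphere_lty : hausdorff_outer k sphere < +oo.
Proof.
pose V := unit_ball_volume R k; pose C : R := (k * k.+2)%:R.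
have V0 : (0 <= V)%R by exact: (unit_ball_volume_ge0 R k).1.
suff : hausdorff_outer k sphere <= (2 * k.+1%:R * (V * (2 * C) ^+ k))%:E.
  by move=> /le_lt_trans; apply; exact: ltry.
apply: ge_ereal_sup => _ [d /= d0 <-].
have [M [M0 Md]] : exists M, (0 < M)%N /\ (C * (2 / M%:R) <= d)%R.
  have C1 : (0 < C + 1)%R by rewrite ltr_wpDl.
  have e0 : (0 < d / (2 * (C + 1)))%R by rewrite divr_gt0// mulr_gt0.
  have [M _ /(_ M (leqnn M))/= Me] := near_infty_natSinv_lt (PosNum e0).
  exists M.+1; split => //.
  apply: (@le_trans _ _ ((C + 1) * (2 * (d / (2 * (C + 1)))))%R).
    by apply: ler_pM; rewrite ?mulr_ge0 ?lerDl ?ler_wpM2l ?(ltW Me).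
  by rewrite le_eqVlt; apply/orP; left; apply/eqP; field; rewrite gt_eqF.
pose I := ('I_k.+1 * bool * {ffun 'I_k -> 'I_M.+1})%type.
pose cell (i : I) : set 'rV[R]_k.+1 := [set x | [/\ sphere x,
  (k.+1%:R^-1 <= (-1) ^+ i.1.2 * x 0 i.1.1)%R &
  (forall l, (i.2 l)%:R <= (x 0 (lift i.1.1 l) + 1) * (M%:R / 2) <= (i.2 l).+1%:R)%R]].
pose c i := if pselect (cell i !=set0) then Some (cell i) else None.
have M2 : (0 < M%:R / 2 :> R)%R by rewrite divr_gt0// ltr0n.
have cellE i x y : cell i x -> cell i y -> (enorm (x - y) <= C * (2 / M%:R))%R.
  move=> [Sx xj xl] [Sy yj yl]; apply: sphere_coord_lipschitz xj yj _ => // l.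
  rewrite -invf_div -(@ler_pM2r _ (M%:R / 2))// mulVf ?gt_eqF//.
  have := xl l; have := yl l; rewrite -[((i.2 l).+1%:R)%R]natr1.
  move: (x 0%R _) (y 0%R _) ((i.2 l)%:R)%R (M%:R / 2)%R M2 => X Y z m m0.
  move=> /andP[Y1 Y2] /andP[X1 X2].
  by rewrite -{1}(gtr0_norm m0) -normrM ler_norml; apply/andP; split; nra.
have := @cover_outer_le_card R _ _ I
  [set A : set 'rV[R]_k.+1 | A !=set0 /\ (diameter A <= d%:E)%E] id
  (@hausdorff_size R k.+1 k) sphere c (V * (C * (2 / M%:R) / 2) ^+ k).
move=> /(_ (@hausdorff_size_ge0 R k.+1 k d)) cov.
apply: le_trans (cov _ _ _) _.
- move=> i A; rewrite /c; case: pselect => // ci [<-]; split => //.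
  by apply: diameter_le => x y cx cy; exact: le_trans (cellE i x y cx cy) Md.
- move=> x Sx; have [j [s xj]] := sphere_large_coord Sx.
  pose v l : R := ((x 0 (lift j l) + 1) * (M%:R / 2))%R.
  have xl l : (0 <= x 0 (lift j l) + 1 <= 2)%R.
    have := coord_le_enorm x (lift j l); rewrite Sx ler_norml => /andP[a b].
    by apply/andP; split; lra.
  have v0 l : (0 <= v l)%R by have /andP[x0 _] := xl l; rewrite mulr_ge0// ltW.
  have vM l : (v l <= M%:R)%R.
    have /andP[_ x2] := xl l.
    rewrite (_ : M%:R = 2 * (M%:R / 2))%R ?ler_pM2r//; first lra.
  have cx : cell (j, s, [ffun l => inord (Num.truncn (v l))]) x.
    split => // l; rewrite ffunE inordK; last first.
      by rewrite ltnS -(ler_nat R); apply: le_trans (vM l); rewrite truncn_le.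
    by have /andP[-> /ltW ->] := truncn_itv (v0 l).
  exists (j, s, [ffun l => inord (Num.truncn (v l))]).
  by rewrite /c; case: pselect => [//|[]]; exists x.
- move=> i; rewrite /c; case: pselect => /= [ci|_].
    exact: hausdorff_size_le ci (cellE i).
  by rewrite lee_fin mulr_ge0// exprn_ge0// divr_ge0// mulr_ge0// divr_ge0.
rewrite lee_fin !card_prod card_bool card_ffun !card_ord.
rewrite !natrM natrX mulrA (_ : _ * _ =
  2 * k.+1%:R * V * (M.+1%:R * (C * (2 / M%:R) / 2)) ^+ k)%R; last first.
  by rewrite [in RHS]exprMn; ring.
rewrite [leRHS]mulrA ler_wpM2l ?mulr_ge0//.
rewrite lerXn2r ?nnegrE ?mulr_ge0 ?divr_ge0 ?mulr_ge0//.
have M1 : (1 <= M%:R :> R)%R by rewrite ler1n.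
rewrite (_ : C * (2 / M%:R) / 2 = C / M%:R)%R; last by field; rewrite gt_eqF// ltr0n.
rewrite mulrCA mulrC ler_wpM2r// ler_pdivrMr ?ltr0n// -natr1; lra.
Qed.

(** A piece of the sphere around the pole of the coordinate j that is a graph over
    a cube of the other coordinates. *)
Definition sphere_cap (j : 'I_k.+1) (a : R) : set 'rV[R]_k.+1 :=
  [set x | [/\ sphere x, (0 <= x 0 j)%R &
               forall l, (0 <= x 0 (lift j l) <= a)%R]].

End sphere_measure.

(** A Lebesgue-type lower bound for covers by cubes, by induction on the dimension:
    the weights absorb, for a fixed value of the last coordinate, whether that
    value is in the last side of the cube, and Tonelli's theorem integrates them. *)
Lemma weighted_cube_cover (R : realType) (a : R) (k : nat) (w : nat -> R)
    (p : nat -> nat -> R) (s : nat -> R) : 0 <= a ->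
  (forall i, 0 <= w i) -> (forall i, 0 <= s i) ->
  (forall y : nat -> R, (forall j, (j < k)%N -> 0 <= y j <= a) ->
    (1 <= \sum_(i <oo)
      (w i * \prod_(j < k) \1_(`[p i j - s i, p i j + s i]%classic) (y j))%:E)%E) ->
  ((a ^+ k)%:E <= \sum_(i <oo) (w i * (2 * s i) ^+ k)%:E)%E.
Proof.
move=> a0; elim: k w => [|k IH] w w0 s0 cov.
  have := cov (fun=> 0) (fun j => ltac:(by [])); rewrite expr0; congr (_ <= _)%E.
  by apply: eq_eseriesr => i _; rewrite big_ord0 expr0.
pose J i : set R := `[p i k - s i, p i k + s i]%classic.
have slice t : 0 <= t <= a ->
    ((a ^+ k)%:E <= \sum_(i <oo) ((w i * (2 * s i) ^+ k) * \1_(J i) t)%:E)%E.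
  move=> ta; have := IH (fun i => w i * \1_(J i) t).
  have -> : (\sum_(i <oo) (w i * \1_(J i) t * (2 * s i) ^+ k)%:E =
    \sum_(i <oo) ((w i * (2 * s i) ^+ k) * \1_(J i) t)%:E)%E.
    by apply: eq_eseriesr => i _; rewrite mulrAC.
  apply => // [i|y ya]; first by rewrite mulr_ge0.
  have yt j : (j < k.+1)%N -> 0 <= (if j == k then t else y j) <= a.
    by rewrite ltnS leq_eqVlt; case: eqP => [//|_]/= jk; exact: ya.
  apply: le_trans (cov _ yt) _.
  rewrite le_eqVlt; apply/orP; left; apply/eqP; apply: eq_eseriesr => i _.
  rewrite big_ord_recr/= eqxx mulrA mulrAC.
  congr (_ * _ * _)%:E; apply: eq_bigr => j _.
  by rewrite ltn_eqF.
have mJ i : measurable (J i) by exact: measurable_itv.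
have c0 i : 0 <= w i * (2 * s i) ^+ k by rewrite mulr_ge0 ?exprn_ge0 ?mulr_ge0.
pose mu := @lebesgue_measure R.
pose A : set R := `[0, a]%classic.
have mA : measurable A by exact: measurable_itv.
have Aa : mu A = a%:E.
  rewrite /mu /A lebesgue_measure_itv/= lte_fin oppr0 addr0.
  by case: ltgtP a0 => // <-.
have -> : (a ^+ k.+1)%:E = (\int[mu]_(t in A) (cst (a ^+ k)%:E) t)%E.
  by rewrite integral_cst// [X in (_ * X)%E](_ : _ = a%:E)// -EFinM exprSr.
apply: (@le_trans _ _ (\int[mu]_(t in A)
    (\sum_(i <oo) ((w i * (2 * s i) ^+ k) * \1_(J i) t)%:E))%E).
  apply: ge0_le_integral_nonmeasurable => t ta; first by rewrite lee_fin exprn_ge0.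
  by apply: slice; move: ta; rewrite /A /= in_itv.
rewrite integral_nneseries//; last 2 first.
- move=> i; apply/measurable_EFinP; apply: measurable_funM.
    exact: measurable_cst.
  exact: measurable_indic (mJ i).
- by move=> i t _; rewrite lee_fin mulr_ge0.
apply: lee_nneseries => [i _ _|i _].
  by apply: integral_ge0 => t _; rewrite lee_fin mulr_ge0.
under eq_integral do rewrite EFinM.
rewrite ge0_integralZl ?lee_fin//; last first.
  by apply/measurable_EFinP; exact: measurable_indic (mJ i).
rewrite integral_indic//; last exact: mJ.
rewrite exprSr mulrA [in leRHS]EFinM; apply: lee_pmul => //.
- by rewrite lee_fin.
apply: (@le_trans _ _ (mu (J i))).
  by apply: le_measure; rewrite ?inE; [exact: measurableI (mJ i) mA|exact: mJ|exact: subIsetl].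
rewrite /mu /J lebesgue_measure_itv/= lte_fin.
case: ifPn => _; last by rewrite lee_fin mulr_ge0.
by rewrite -EFinB lee_fin; lra.
Qed.


(** The projection forgetting the coordinate j maps the cap onto a cube and a set of
    diameter d into a cube of side 2 d, so the covers of the cap obey the lower
    bound for cubes.  The assumption on a makes the cap a graph over the cube. *)
Lemma hausdorff_sphere_cap_gt0 (R : realType) (k : nat) (j : 'I_k.+1) (a : R) :
  0 < a -> k%:R * a ^+ 2 <= 1 ->
  ((unit_ball_volume R k * (a / 4) ^+ k)%:E <= hausdorff_outer k (sphere_cap j a))%E.
Proof.
move=> a0 ka; apply: le_trans (hausdorff_delta_le _ _ (@ltr01 R)).
apply: le_ereal_inf_tmp => _ [F [PF capF] <-].
have V0 := (unit_ball_volume_ge0 R k).1.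
(* An unused index of the cover gets weight 0. *)
pose w i : R := (F i : bool)%:R.
pose s i := fine (diameter (odflt set0 (F i))).
pose p i (l : nat) : R :=
  xget 0 (odflt set0 (F i)) 0 (if insub l is Some o then lift j (o : 'I_k) else j).
have s0 i : 0 <= s i.
  rewrite /s; case E : (F i) => [U|]/=.
    by rewrite fine_ge0// diameter_ge0//; case: (PF _ _ E).
  by rewrite /diameter setX0 image_set0 ereal_sup0.
have w0 i : 0 <= w i by [].
have cov : ((a ^+ k)%:E <= \sum_(i <oo) (w i * (2 * s i) ^+ k)%:E)%E.
  apply: (@weighted_cube_cover R a k w p s (ltW a0) w0 s0) => y ya.
  pose sq : R := \sum_(l < k) y l ^+ 2.
  have sq1 : sq <= 1.
    apply: le_trans ka; apply: le_trans (ler_sum _ (G := fun=> a ^+ 2) _) _.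
      by move=> l _; have /andP[y0 yla] := ya l (ltn_ord l); rewrite lerXn2r ?nnegrE// ltW.
    by rewrite sumr_const card_ord mulr_natl.
  pose x : 'rV[R]_k.+1 :=
    \row_i (if unlift j i is Some l then y l else Num.sqrt (1 - sq)).
  have xj : x 0 j = Num.sqrt (1 - sq) by rewrite mxE unlift_none.
  have xl l : x 0 (lift j l) = y l by rewrite mxE liftK.
  have [i _ Fx] : (\bigcup_i oapp id set0 (F i)) x.
    apply: capF; split.
    - rewrite /unit_sphere/= /enorm (bigD1_ord j)//= xj sqr_sqrtr ?subr_ge0//.
      by rewrite (eq_bigr (fun l : 'I_k => y l ^+ 2)) ?subrK ?sqrtr1// => l _; rewrite xl.
    - by rewrite xj sqrtr_ge0.
    - by move=> l; rewrite xl; exact: ya.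
  apply: (@le_trans _ _ (\sum_(0 <= m < i.+1) (w m *
      \prod_(l < k) \1_(`[p m l - s m, p m l + s m]%classic) (y l))%:E)%E); last first.
    apply: nneseries_lim_ge => m _ _; rewrite lee_fin mulr_ge0//.
    by apply: prodr_ge0 => l _; rewrite indicE.
  rewrite big_nat_recr//= -[leLHS]add0e; apply: leeD.
    apply: sume_ge0 => m _; rewrite lee_fin mulr_ge0//.
    by apply: prodr_ge0 => l _; rewrite indicE.
  rewrite lee_fin big1 ?mulr1 => [|l _]; first by rewrite /w; case: (F i) Fx.
  rewrite indicE mem_set//= in_itv/= /p /s valK.
  case E : (F i) Fx => [U|]//= Ux.
  have [_ Ud] := PF _ _ E.
  have Up : U (xget 0 U) by apply: xgetPex; exists x.
  have := le_trans (coord_le_enorm (x - xget 0 U) (lift j l)) (enorm_le_diameter Ud Ux Up).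
  by rewrite !mxE liftK ler_distl.
have V4 : 0 <= unit_ball_volume R k / 4 ^+ k by rewrite divr_ge0// exprn_ge0.
rewrite expr_div_n mulrCA (mulrC (a ^+ k)) EFinM.
apply: le_trans (lee_wpmul2l _ cov) _; first by rewrite lee_fin.
rewrite -nneseriesZl => [|i _]; last by rewrite lee_fin mulr_ge0// exprn_ge0// mulr_ge0.
apply: lee_nneseries => [i _ _|i _].
  by rewrite -EFinM lee_fin !mulr_ge0// exprn_ge0// mulr_ge0.
rewrite -EFinM /w /s; case: (F i) => [U|] /=; last by rewrite mul0r mulr0.
rewrite lee_fin mul1r -mulrA ler_wpM2l// -exprVn -exprMn.
by rewrite le_eqVlt; apply/orP; left; apply/eqP; congr (_ ^+ k); lra.
Qed.

(** * Translations and measurable sets for the Lebesgue measure *)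

Section lebesgue_space.
Context (R : realType) (n : nat).
Local Notation V := 'rV[R]_n.
Local Notation leb := (lebesgue_rV R n).
Local Notation T := (lebesgueType R n).
Local Open Scope ereal_scope.

Lemma lebesgue_outer_shift_le (A : set V) (z : V) :
  lebesgue_outer [set x | A (x + z)%R] <= lebesgue_outer A.
Proof.
apply: le_ereal_inf_tmp => _ [F [_ AF] <-].
pose G i := omap (fun ab : V * V => (ab.1 - z, ab.2 - z)%R) (F i).
have -> : \sum_(i <oo) oapp (@box_volume R n) 0 (F i) =
          \sum_(i <oo) oapp (@box_volume R n) 0 (G i).
  apply: eq_eseriesr => i _; rewrite /G; case: (F i) => [[a b]|]//=.
  rewrite /box_volume/=; congr _%:E; apply: eq_bigr => j _; rewrite !mxE.
  by congr Num.max; ring.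
apply: cover_outer_le_cover => // x /= /AF[i _ Fx]; exists i => //.
rewrite /G; case: (F i) Fx => [[a b]|]//= abx j; rewrite !mxE.
by have := abx j; rewrite !mxE ltrBlDr lerBrDr.
Qed.

Lemma lebesgue_outer_shift (A : set V) (z : V) :
  lebesgue_outer [set x | A (x + z)%R] = lebesgue_outer A.
Proof.
apply/eqP; rewrite eq_le lebesgue_outer_shift_le/=.
have := lebesgue_outer_shift_le [set x | A (x + z)%R] (- z)%R.
congr (_ <= _); congr lebesgue_outer.
by apply/seteqP; split => x /=; rewrite subrK.
Qed.

Lemma measurable_shift (A : set T) (z : V) :
  measurable A -> measurable ([set x : V | A (x + z)%R] : set T).
Proof.
move=> mA; change ((@lebesgue_outer R n).-caratheodory [set x | A (x + z)%R]).
have {}mA : (@lebesgue_outer R n).-caratheodory A := mA.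
move=> X; have := mA [set x | X (x - z)%R].
rewrite -(lebesgue_outer_shift X (- z)%R) => ->.
congr (_ + _); rewrite -[RHS](lebesgue_outer_shift _ (- z)%R);
  by congr lebesgue_outer; apply/seteqP; split => x /=; rewrite subrK.
Qed.

Lemma measurable_fun_shift (z : V) :
  measurable_fun [set: T] ((fun x : V => x + z)%R : T -> T).
Proof. by move=> _ Y mY; rewrite setTI; exact: (measurable_shift z mY). Qed.

Lemma ge0_integral_shift (f : T -> \bar R) (z : V) :
  measurable_fun [set: T] f -> (forall x, 0 <= f x) ->
  \int[leb]_x f ((x : V) + z)%R = \int[leb]_x f x.
Proof.
move=> mf f0.
pose sh : T -> T := fun x : V => (x + z)%R.
have msh : measurable_fun [set: T] sh := measurable_fun_shift z.
have := ge0_integral_pushforward msh leb measurableT mf (fun x _ => f0 x).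
rewrite preimage_setT => <-.
pose nu : {measure set T -> \bar R} := pushforward leb sh.
rewrite (@eq_measure_integral _ T R setT leb (nu msh) f)// => A mA _.
exact: (lebesgue_outer_shift (A : set V) z).
Qed.

(** Cutting a box by a hyperplane orthogonal to an axis yields two boxes whose
    volumes add up, so a cover can be cutoff_mul without changing its total volume. *)
Lemma measurable_half_space (i : 'I_n) (a : R) :
  measurable ([set x : V | (x 0 i <= a)%R] : set T).
Proof.
apply: le_caratheodory_measurable => X.
apply: le_ereal_inf_tmp => _ [F [_ XF] <-].
pose lo (ab : V * V) :=
  (ab.1, \row_j if j == i then Num.min (ab.2 0 j) a else ab.2 0 j)%R : V * V.
pose hi (ab : V * V) :=
  (\row_j if j == i then Num.max (ab.1 0 j) a else ab.1 0 j, ab.2)%R : V * V.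
have bv0 (o : option (V * V)) : 0 <= oapp (@box_volume R n) 0 o.
  by case: o => //= ab; exact: box_volume_ge0.
have -> : \sum_(m <oo) oapp (@box_volume R n) 0 (F m) =
    \sum_(m <oo) oapp (@box_volume R n) 0 (omap lo (F m)) +
    \sum_(m <oo) oapp (@box_volume R n) 0 (omap hi (F m)).
  rewrite -nneseriesD; last 2 first.
  - by move=> m _ _; exact: bv0.
  - by move=> m _ _; exact: bv0.
  apply: eq_eseriesr => m _; case: (F m) => [[b c]|]/=; last by rewrite adde0.
  rewrite /box_volume/= -EFinD; congr _%:E.
  pose P := (\prod_(j < n | j != i) Num.max 0 (c 0 j - b 0 j))%R.
  have prodE (b' c' : V) : (forall j, j != i -> b' 0 j = b 0 j /\ c' 0 j = c 0 j)%R ->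
      (\prod_j Num.max 0 (c' 0 j - b' 0 j) = Num.max 0 (c' 0 i - b' 0 i) * P)%R.
    move=> bc; rewrite (bigD1 i)//=; congr (_ * _)%R.
    by apply: eq_bigr => j /bc[-> ->].
  rewrite !prodE; last 3 first.
  - by move=> j /negbTE ji; rewrite !mxE ji.
  - by move=> j /negbTE ji; rewrite !mxE ji.
  - by [].
  rewrite -mulrDl !mxE eqxx; congr (_ * _)%R.
  move: (c 0%R i) (b 0%R i) => ci bi; clear.
  rewrite /Num.max /Num.min.
  case: (ltP ci a) => ca; case: (ltP bi a) => ba; do ?case: ltP => ?; lra.
apply: leeD; apply: cover_outer_le_cover => // x [/XF[m _ Fx] /= xa]; exists m => //.
  case: (F m) Fx => [[b c]|]//= bcx j; rewrite mxE; case: eqP => [->|//].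
  by have /andP[-> xc] := bcx i; rewrite le_min xc.
case: (F m) Fx => [[b c]|]//= bcx j; rewrite mxE; case: eqP => [->|//].
by have /andP[bx ->] := bcx i; rewrite gt_max bx andbT/= ltNge; apply/negP.
Qed.

Lemma measurable_box (ab : V * V) : measurable (box ab : set T).
Proof.
rewrite (_ : box ab = \bigcap_(i in [set: 'I_n])
  (~` [set x : V | (x 0 i <= ab.1 0 i)%R] `&` [set x : V | (x 0 i <= ab.2 0 i)%R])).
  apply: fin_bigcap_measurable => // i _.
  by apply: measurableI; [apply: measurableC|]; exact: measurable_half_space.
apply/seteqP; split => x /= abx i => [_|].
  by have /andP[ax xb] := abx i; split => //=; rewrite leNgt ax.
by have [/negP] := abx i I; rewrite -ltNge => -> ->.
Qed.

(** An open set is the union of the boxes with rational corners that it contains. *)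
Lemma measurable_open (U : set V) : open U -> measurable (U : set T).
Proof.
move=> oU; pose J := ({ffun 'I_n -> rat} * {ffun 'I_n -> rat})%type.
pose bx (fg : J) : V * V := (\row_i ratr (fg.1 i), \row_i ratr (fg.2 i))%R.
pose F (fg : J) : set T := if `[< box (bx fg) `<=` U >] then box (bx fg) else set0.
rewrite (_ : U = \bigcup_fg F fg).
  apply: countable_bigcupT_measurable => [|fg]; first exact: countableP.
  rewrite /F.
  by case: ifPn => // _; exact: measurable_box.
apply/seteqP; split => x; last first.
  by move=> [fg _]; rewrite /F; case: ifPn => // /asboolP; exact.
move=> Ux; have [e /= e0 eU] : nbhs_ball x U.
  by apply/nbhs_ballP; exact: open_nbhs_nbhs.
have /choice[f fP] : forall i, exists q : rat, (x 0 i - e < ratr q < x 0 i)%R.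
  move=> i; have /rat_in_itvoo[q] : (x 0 i - e < x 0 i)%R by rewrite gtrBl.
  by rewrite in_itv/= => ?; exists q.
have /choice[g gP] : forall i, exists q : rat, (x 0 i < ratr q < x 0 i + e)%R.
  move=> i; have /rat_in_itvoo[q] : (x 0 i < x 0 i + e)%R by rewrite ltrDl.
  by rewrite in_itv/= => ?; exists q.
exists ([ffun i => f i], [ffun i => g i]) => //; rewrite /F ifT.
  move=> i /=; rewrite !mxE !ffunE.
  by have /andP[_ ->] := fP i; have /andP[/ltW -> _] := gP i.
apply/asboolP => y xy; apply: eU => /=.
rewrite -ball_normE/= /Num.norm/= mx_normrE; apply: bigmax_lt => // -[l i] _.
rewrite ord1 /= !mxE.
have /= := xy i; rewrite !mxE !ffunE => /andP[fy yg].
have /andP[xf _] := fP i; have /andP[_ gx] := gP i.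
rewrite ltr_distl; apply/andP; split; lra.
Qed.

Lemma continuous_measurable (f : V -> R) : continuous f ->
  measurable_fun [set: T] (f : T -> R).
Proof.
move=> /continuousP cf; apply: (measurability _ (RGenOpens.measurableE R)).
move=> _ [_ [a [b ->] <-]]; rewrite setTI; apply: measurable_open; apply: cf.
exact: interval_open.
Qed.

End lebesgue_space.

(** * Continuity of translations on sets of finite measure *)

Section translation_continuity_sets.
Context (R : realType) (n : nat).
Local Notation V := 'rV[R]_n.
Local Notation lebo := (@lebesgue_outer R n).
Local Open Scope ereal_scope.
Implicit Types (A B : set V) (z : V).

Definition shift_set A z : set V := [set x | A (x + z)%R].

Definition shift_continuous_set A := forall e : R, (0 < e)%R ->
  exists2 rho : R, (0 < rho)%R & forall z, (enorm z < rho)%R ->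
    lebo (A `\` shift_set A z) <= e%:E.

Lemma lebesgue_outer_setD_shift (z : V) A B :
  lebo (shift_set A z `\` shift_set B z) = lebo (A `\` B).
Proof. exact: (lebesgue_outer_shift (A `\` B) z). Qed.

Lemma lebesgue_outerU A B : lebo (A `|` B) <= lebo A + lebo B.
Proof. exact: outer_measureU2. Qed.

Lemma lebesgue_outer_box (ab : V * V) : lebo (box ab) <= box_volume ab.
Proof.
have := @cover_outer_le_card R V (V * V)%type unit setT (@box R n) (@box_volume R n)
  (box ab) (fun=> Some ab) (fine (box_volume ab)) (@box_volume_ge0 R n).
by rewrite card_unit mul1r; apply => // x abx; exists tt.
Qed.

(** A point that leaves a box when translated by z lies in a slab of thickness
    at most |z| along one of the faces. *)
Lemma shift_continuous_box (ab : V * V) : shift_continuous_set (box ab).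
Proof.
move=> e e0; pose P (i : 'I_n) := (\prod_(j < n | j != i) Num.max 0 (ab.2 0 j - ab.1 0 j))%R.
have P0 i : (0 <= P i)%R by apply: prodr_ge0 => j _; rewrite le_max lexx.
pose Q := (\sum_i P i)%R.
have Q0 : (0 <= Q)%R by exact: sumr_ge0.
pose S := (1 + (n * 2)%:R * Q)%R.
have S0 : (0 < S)%R by rewrite ltr_wpDr// mulr_ge0.
exists (e / S)%R; first by rewrite divr_gt0.
move=> z zS.
pose face (ib : 'I_n * bool) : V * V := if ib.2 then
  (\row_j (if j == ib.1 then ab.2 0 j - enorm z else ab.1 0 j), ab.2)%R else
  (ab.1, \row_j (if j == ib.1 then ab.1 0 j + enorm z else ab.2 0 j))%R.
have faceE i b : box_volume (face (i, b)) = (enorm z * P i)%:E.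
  rewrite /box_volume; congr _%:E; rewrite (bigD1 i)//=; congr (_ * _)%R.
    case: b; rewrite /face/= mxE eqxx.
      by rewrite opprB addrC subrK max_r ?enorm_ge0.
    by rewrite addrC addKr max_r ?enorm_ge0.
  by apply: eq_bigr => j /negbTE ji; case: b; rewrite /face/= mxE ji.
apply: le_trans (@cover_outer_le_card R V (V * V)%type ('I_n * bool)%type setT
  (@box R n) (@box_volume R n) (box ab `\` shift_set (box ab) z)
  (fun ib => Some (face ib)) (enorm z * Q) (@box_volume_ge0 R n) _ _ _) _.
- by [].
- move=> x [abx /existsNP[i /negP]] /=; rewrite !mxE negb_and -leNgt -ltNge => out.
  have zi := coord_le_enorm z i; move: zi; rewrite ler_norml => /andP[z1 z2].
  have /andP[ax xb] := abx i.
  have [xa|xa] := leP (x 0%R i + z 0%R i)%R (ab.1 0%R i).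
    exists (i, false) => j /=; rewrite mxE; case: eqP => [->|_]; last exact: abx.
    by rewrite ax/=; lra.
  exists (i, true) => j /=; rewrite mxE; case: eqP => [->|_]; last exact: abx.
  move: out; rewrite leNgt xa/= => bx; rewrite xb andbT; lra.
- move=> [i b] /=; rewrite faceE lee_fin ler_wpM2l ?enorm_ge0//.
  by rewrite /Q (bigD1 i)//= lerDl sumr_ge0.
rewrite card_prod card_ord card_bool lee_fin mulrCA.
apply: (@le_trans _ _ (e / S * S)%R); last by rewrite divfK// gt_eqF.
apply: ler_pM; rewrite ?enorm_ge0 ?mulr_ge0 ?(ltW zS)//.
by rewrite /S lerDr.
Qed.

Lemma shift_continuous_setU A B : shift_continuous_set A ->
  shift_continuous_set B -> shift_continuous_set (A `|` B).
Proof.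
move=> cA cB e e0; have e2 : (0 < e / 2)%R by rewrite divr_gt0.
have [r1 r10 A1] := cA _ e2; have [r2 r20 B1] := cB _ e2.
exists (Num.min r1 r2); first by rewrite lt_min r10.
move=> z; rewrite lt_min => /andP[zr1 zr2].
rewrite (splitr e) EFinD; apply: le_trans (leeD (A1 z zr1) (B1 z zr2)).
apply: le_trans (lebesgue_outerU _ _); apply: le_outer_measure.
by move=> x [[Ax|Bx] /not_orP[nA nB]]; [left|right].
Qed.

(** A point of A that leaves A under translation is in A but not in U, or leaves U,
    or lands in U outside of A; the last event has the measure of U \ A by
    translation invariance. *)
Lemma shift_continuous_set_approx A :
  (forall e : R, (0 < e)%R -> exists U, [/\ shift_continuous_set U,
     lebo (A `\` U) <= e%:E & lebo (U `\` A) <= e%:E]) ->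
  shift_continuous_set A.
Proof.
move=> appr e e0; have e3 : (0 < e / 3)%R by rewrite divr_gt0.
have [U [cU AU UA]] := appr _ e3; have [rho rho0 Urho] := cU _ e3.
exists rho => // z /Urho Uz.
have -> : e%:E = (e / 3)%:E + (e / 3)%:E + (e / 3)%:E.
  by rewrite -!EFinD; congr _%:E; field.
rewrite -(lebesgue_outer_setD_shift z) in UA.
apply: le_trans (leeD (leeD AU Uz) UA).
apply: le_trans (leeD (lebesgue_outerU _ _) (lexx _)).
apply: le_trans (lebesgue_outerU _ _); apply: le_outer_measure => x [Ax Azx].
have [Ux|Ux] := pselect (U x); last by left; left.
by have [Uzx|Uzx] := pselect (U (x + z)%R); [right|left; right].
Qed.

(** A nearly optimal cover by boxes, truncated to finitely many of them, is close
    to E in measure, and finite unions of boxes are already known to move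
    continuously. *)
Lemma shift_continuous_measurable (E : set (lebesgueType R n)) :
  measurable E -> lebo E < +oo -> shift_continuous_set E.
Proof.
move=> mE Efin; apply: shift_continuous_set_approx => e e0.
have Ef : lebo E \is a fin_num by rewrite ge0_fin_numE ?outer_measure_ge0.
have [_ [F [_ EF] <-] Fe] := lb_ereal_inf_adherent e0 Ef.
have vF0 k : 0 <= oapp (@box_volume R n) 0 (F k).
  by case: (F k) => //= ab; exact: box_volume_ge0.
have Ffin : \sum_(k <oo) oapp (@box_volume R n) 0 (F k) < +oo.
  by apply: lt_trans Fe _; rewrite -/(lebo E) lte_add_pinfty ?ltry.
have tail := nneseries_tail_cvg Ffin (fun k _ => vF0 k).
have [K _ /(_ K (leqnn K)) /= KF] : \forall K \near \oo,
    \sum_(K <= k <oo) oapp (@box_volume R n) 0 (F k) < e%:E.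
  by apply: (tail [set y | y < e%:E]); apply: (@open_ereal_lt' _ 0 e%:E); rewrite lte_fin.
pose B k := oapp (@box R n) set0 (F k).
have Bv k : lebo (B k) <= oapp (@box_volume R n) 0 (F k).
  rewrite /B; case: (F k) => [ab|] /=; first exact: lebesgue_outer_box.
  by rewrite outer_measure0.
exists (\big[setU/set0]_(k < K) B k); split.
- apply: (big_ind shift_continuous_set).
  + move=> d d0; exists 1%R => // z _.
    by rewrite set0D outer_measure0 lee_fin ltW.
  + exact: shift_continuous_setU.
  + move=> k _; rewrite /B; case: (F k) => [ab|] /=; first exact: shift_continuous_box.
    by move=> d d0; exists 1%R => // z _; rewrite set0D outer_measure0 lee_fin ltW.
- apply: le_trans (ltW KF).
  pose C k := if (k < K)%N then set0 else B k.
  apply: (@le_trans _ _ (lebo (\bigcup_k C k))).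
    apply: le_outer_measure => x [Ex]; rewrite -(bigcup_mkord _ B) => nK.
    have [k _ Fk] := EF x Ex; exists k => //; rewrite /C; case: ifPn => // kK.
    by apply: nK; exists k.
  apply: le_trans (outer_measure_sigma_subadditive _ _) _.
  rewrite (@nneseries_split _ _ 0 K); last by move=> i _; exact: outer_measure_ge0.
  rewrite add0n big_nat big1 ?add0e; last first.
    by move=> i /andP[_ il]; rewrite /C il outer_measure0.
  apply: lee_nneseries => [i _ _|i _]; first exact: outer_measure_ge0.
  rewrite /C; case: ifPn => // _; last exact: Bv.
  by rewrite outer_measure0.
- pose W := \bigcup_k B k.
  have WF : lebo W <= \sum_(k <oo) oapp (@box_volume R n) 0 (F k).
    by apply: cover_outer_le_cover.
  have : lebo W = lebo (W `&` E) + lebo (W `&` ~` E) := mE W.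
  rewrite (setIidr EF) => WE.
  apply: (@le_trans _ _ (lebo (W `&` ~` E))).
    apply: le_outer_measure => x [+ nE]; rewrite -(bigcup_mkord _ B) => -[k _ Bk].
    by split => //; exists k.
  by rewrite -(leeD2lE _ _ Ef) -WE (le_trans WF)// ltW.
Qed.

End translation_continuity_sets.

(** * Integrals of the q-th power of differences *)

Section powR_sum.
Context (R : realType) (q : R).
Hypothesis q1 : 1 <= q.

Let q0 : 0 <= q := le_trans ler01 q1.

Lemma powR2_ge1 : 1 <= (2 : R) `^ q.
Proof. by apply: le_trans (le1r_powR _ q1) => //; rewrite ler1n. Qed.

Lemma powR_add_le (a b : R) : 0 <= a -> 0 <= b ->
  (a + b) `^ q <= 2 `^ q * (a `^ q + b `^ q).
Proof.
move=> a0 b0; wlog ab : a b a0 b0 / a <= b.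
  move=> H; have [ab|/ltW ba] := leP a b; first exact: H.
  by rewrite addrC (addrC (_ `^ _)) H.
apply: (@le_trans _ _ ((2 * b) `^ q)).
  by apply: (ge0_ler_powR q0); rewrite ?nnegrE ?addr_ge0 ?mulr_ge0//; lra.
by rewrite powRM// ler_wpM2l ?powR_ge0// lerDr powR_ge0.
Qed.

End powR_sum.

Section translation_increment.
Context (R : realType) (n m : nat) (q : R).
Hypothesis q1 : 1 <= q.
Local Notation V := 'rV[R]_n.
Local Notation W := 'rV[R]_m.
Local Notation leb := (lebesgue_rV R n).
Local Notation T := (lebesgueType R n).
Local Open Scope ereal_scope.
Implicit Types (u v : V -> W) (z : V).

Let q0 : (0 <= q)%R := le_trans ler01 q1.
Let qn0 : q != 0%R. Proof. by rewrite gt_eqF// (lt_le_trans ltr01). Qed.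

Definition Lq_pow u : \bar R := \int[leb]_x (enorm (u x) `^ q)%:E.

Definition increment u z : \bar R := Lq_pow (fun x => u (x + z) - u x)%R.

Lemma measurable_enorm_powR (D : set T) u : measurable_on D u ->
  measurable_fun D (fun x : T => enorm (u x) `^ q)%R.
Proof.
move=> mu; apply: (measurableT_comp (measurable_powR q)).
rewrite (_ : (fun x : T => _) = Num.sqrt \o (fun x : T => \sum_i u x 0 i ^+ 2))%R//.
apply: measurableT_comp.
  by apply: continuous_measurable_fun; exact: sqrt_continuous.
by apply: measurable_sum => i; apply: measurable_funX; exact: mu.
Qed.

Lemma measurable_on_shift u z : measurable_on setT u ->
  measurable_on setT (fun x => u (x + z)%R).
Proof.
move=> mu j; exact: (measurableT_comp (mu j) (@measurable_fun_shift R n z)).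
Qed.

Lemma measurable_onD u v : measurable_on setT u -> measurable_on setT v ->
  measurable_on setT (fun x => u x + v x)%R.
Proof.
move=> mu mv j; rewrite (_ : (fun _ => _) = (fun x => u x 0 j + v x 0 j)%R).
  by apply: measurable_funD; [exact: mu|exact: mv].
by apply/funext => x; rewrite mxE.
Qed.

Lemma measurable_onB u v : measurable_on setT u -> measurable_on setT v ->
  measurable_on setT (fun x => u x - v x)%R.
Proof.
move=> mu mv j; rewrite (_ : (fun _ => _) = (fun x => u x 0 j - v x 0 j)%R).
  by apply: measurable_funB; [exact: mu|exact: mv].
by apply/funext => x; rewrite !mxE.
Qed.

Lemma measurable_on_increment u z : measurable_on setT u ->
  measurable_on setT (fun x => u (x + z) - u x)%R.
Proof. by move=> mu; exact: (measurable_onB (measurable_on_shift z mu) mu). Qed.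

Lemma Lq_pow_ge0 u : 0 <= Lq_pow u.
Proof. by apply: integral_ge0 => x _; rewrite lee_fin powR_ge0. Qed.

Lemma increment_ge0 u z : 0 <= increment u z. Proof. exact: Lq_pow_ge0. Qed.

(** A substitute for the triangle inequality in L^q, at the price of a factor 2^q. *)
Lemma le_Lq_pow_add u v w : measurable_on setT v ->
  (forall x, enorm (w x) <= enorm (u x) + enorm (v x))%R ->
  Lq_pow w <= (2 `^ q)%:E * (Lq_pow u + Lq_pow v).
Proof.
move=> mv wuv.
have c0 : (0 < 2 `^ q :> R)%R by rewrite (lt_le_trans ltr01)// powR2_ge1.
apply: (@le_trans _ _ ((2 `^ q)%:E *
    \int[leb]_x ((enorm (u x) `^ q)%:E + (enorm (v x) `^ q)%:E))).
  apply: ge0_integral_le_scale => // x _.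
  - by rewrite lee_fin powR_ge0.
  - by rewrite -EFinD lee_fin addr_ge0 ?powR_ge0.
  - rewrite -EFinD -EFinM lee_fin.
    apply: le_trans (powR_add_le q1 (enorm_ge0 _) (enorm_ge0 _)).
    by apply: (ge0_ler_powR q0); rewrite ?nnegrE ?addr_ge0 ?enorm_ge0.
rewrite lee_pmul2l//.
apply: (@ge0_integral_le_add _ T R leb setT (fun x => (enorm (u x) `^ q)%:E) _
  (fun x => enorm (v x) `^ q)%R measurableT (measurable_enorm_powR mv)).
- by move=> x _; rewrite powR_ge0.
- by move=> x _; rewrite lee_fin powR_ge0.
- by move=> x _; rewrite -EFinD lee_fin addr_ge0 ?powR_ge0.
- by move=> x _; exact: lexx.
Qed.

Lemma Lq_pow_shift u z : measurable_on setT u ->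
  Lq_pow (fun x => u (x + z)%R) = Lq_pow u.
Proof.
move=> mu; apply: (@ge0_integral_shift R n (fun x : T => (enorm (u x) `^ q)%:E) z).
  by apply/measurable_EFinP; exact: measurable_enorm_powR.
by move=> x; rewrite lee_fin powR_ge0.
Qed.

(** Going from x to x + z + w through x + z, by translation invariance. *)
Lemma increment_add u z w : measurable_on setT u ->
  increment u (z + w)%R <= (2 `^ q)%:E * (increment u z + increment u w).
Proof.
move=> mu; rewrite /increment -(@Lq_pow_shift (fun x => u (x + w) - u x)%R z).
  apply: le_Lq_pow_add => [|x].
    by apply: (@measurable_on_shift (fun x => u (x + w) - u x)%R); exact: measurable_on_increment.
  by rewrite addrA [leRHS]addrC enorm_triangle.
exact: measurable_on_increment.
Qed.

Lemma increment_opp u z : measurable_on setT u ->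
  increment u (- z)%R = increment u z.
Proof.
move=> mu; rewrite /increment -(@Lq_pow_shift (fun x => u (x - z) - u x)%R z).
  by apply: eq_integral => x _; rewrite addrK enormB.
exact: measurable_on_increment.
Qed.

Lemma increment0 u : increment u 0%R = 0.
Proof.
rewrite /increment /Lq_pow integral0_eq// => x _.
by rewrite addr0 subrr enorm0 powR0.
Qed.

Lemma increment_le_Lq_pow u z : measurable_on setT u ->
  increment u z <= (2 `^ q)%:E * (Lq_pow u + Lq_pow u).
Proof.
move=> mu; rewrite -[X in _ <= _ * (X + _)](@Lq_pow_shift u z)//.
apply: le_Lq_pow_add => // x; apply: le_trans (enormD _ _) _.
by rewrite enormN.
Qed.

Lemma integral_increment_div u z (c : R) : (0 < c)%R -> measurable_on setT u ->
  \int[leb]_x (enorm (u (x + z)%R - u x) `^ q / c)%:E = c^-1%:E * increment u z.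
Proof.
move=> c0 mu; rewrite /increment /Lq_pow.
under eq_integral do rewrite mulrC EFinM.
have mi := measurable_enorm_powR (measurable_on_increment z mu).
have ci : 0 <= c^-1%:E :> \bar R by rewrite lee_fin invr_ge0 ltW.
rewrite (ge0_integralZl _ measurableT (iffRL (measurable_EFinP _ _) mi) _ ci); first by [].
by move=> x _; rewrite lee_fin powR_ge0.
Qed.

Definition shift_continuous u := measurable_on setT u /\
  forall e : R, (0 < e)%R -> exists2 rho : R, (0 < rho)%R &
    forall z, (enorm z < rho)%R -> increment u z <= e%:E.

Lemma shift_continuousD u v : shift_continuous u -> shift_continuous v ->
  shift_continuous (fun x => u x + v x)%R.
Proof.
move=> [mu cu] [mv cv]; split; first exact: measurable_onD.
move=> e e0.
have c0 : (0 < 2 `^ q :> R)%R by rewrite (lt_le_trans ltr01)// powR2_ge1.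
have e2 : (0 < e / 2 / 2 `^ q)%R by rewrite !divr_gt0.
have [r1 r10 u1] := cu _ e2; have [r2 r20 v2] := cv _ e2.
exists (Num.min r1 r2); first by rewrite lt_min r10.
move=> z; rewrite lt_min => /andP[zr1 zr2].
apply: le_trans (le_Lq_pow_add (u := (fun x => u (x + z) - u x)%R)
  (v := (fun x => v (x + z) - v x)%R) _ _) _.
- exact: measurable_on_increment.
- by move=> x; apply: le_trans (enormD _ _); rewrite opprD addrACA.
- rewrite -lee_pdivlMl//; apply: le_trans (leeD (u1 _ zr1) (v2 _ zr2)) _.
  rewrite -EFinD -EFinM lee_fin le_eqVlt; apply/orP; left; apply/eqP.
  by field; rewrite gt_eqF.
Qed.

Lemma shift_continuous_approx u : measurable_on setT u ->
  (forall e : R, (0 < e)%R -> exists2 v, shift_continuous v &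
     Lq_pow (fun x => u x - v x)%R <= e%:E) ->
  shift_continuous u.
Proof.
move=> mu appr; split => // e e0.
have c0 : (0 < 2 `^ q :> R)%R by rewrite (lt_le_trans ltr01)// powR2_ge1.
have e2 : (0 < e / 2 / 2 `^ q)%R by rewrite !divr_gt0.
have e4 : (0 < e / 2 / 2 `^ q / 2 / 2 `^ q)%R by rewrite !divr_gt0.
have [v [mv cv] uv] := appr _ e4; have [rho rho0 vrho] := cv _ e2.
exists rho => // z /vrho vz.
have muv : measurable_on setT (fun x => u x - v x)%R by exact: measurable_onB.
apply: le_trans (le_Lq_pow_add (u := (fun x => v (x + z) - v x)%R)
  (v := (fun x => (u (x + z) - v (x + z)) - (u x - v x))%R) _ _) _.
- exact: (measurable_on_increment z muv).
- move=> x; apply: le_trans (enormD _ _); rewrite le_eqVlt; apply/orP; left.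
  by apply/eqP; congr enorm; apply/rowP => i; rewrite !mxE; ring.
- rewrite -lee_pdivlMl//.
  have dz : increment (fun x => u x - v x)%R z <= (e / 2 / 2 `^ q)%:E.
    apply: le_trans (increment_le_Lq_pow z muv) _.
    rewrite -lee_pdivlMl//; apply: le_trans (leeD uv uv) _.
    rewrite -EFinD -EFinM lee_fin le_eqVlt; apply/orP; left; apply/eqP.
    by field; rewrite gt_eqF.
  apply: le_trans (leeD vz dz) _.
  rewrite -EFinD -EFinM lee_fin le_eqVlt; apply/orP; left; apply/eqP.
  by field; rewrite gt_eqF.
Qed.

End translation_increment.

(** * Continuity of translations in L^q *)

Section translation_continuity.
Context (R : realType) (n m : nat) (q : R).
Hypothesis q1 : 1 <= q.
Local Notation V := 'rV[R]_n.
Local Notation W := 'rV[R]_m.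
Local Notation leb := (lebesgue_rV R n).
Local Notation lebo := (@lebesgue_outer R n).
Local Notation T := (lebesgueType R n).
Local Open Scope ereal_scope.

Let q0 : (0 <= q)%R := le_trans ler01 q1.
Let qn0 : q != 0%R. Proof. by rewrite gt_eqF// (lt_le_trans ltr01). Qed.

Import HBNNSimple.

Lemma measurable_on_scale (f : T -> R) (w : W) :
  measurable_fun [set: T] f -> measurable_on setT (fun x : V => f x *: w)%R.
Proof.
move=> mf j; rewrite (_ : (fun _ => _) = (fun x => f x * w 0 j)%R).
  by apply: measurable_funM => //; exact: measurable_cst.
by apply/funext => x; rewrite mxE.
Qed.

Lemma shift_continuous_indic (E : set T) (w : W) : measurable E ->
  lebo E < +oo -> shift_continuous q (fun x : V => (\1_E x : R) *: w)%R.
Proof.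
move=> mE Efin; split.
  by apply: measurable_on_scale; exact: measurable_indic.
move=> e e0; pose c := (enorm w `^ q + 1)%R.
have c0 : (0 < c)%R by rewrite ltr_wpDl// powR_ge0.
have ec0 : (0 < e / c / 2)%R by rewrite !divr_gt0.
have [rho rho0 Erho] := shift_continuous_measurable mE Efin ec0.
exists rho => // z zrho.
pose A : set T := E `\` shift_set E z; pose B : set T := shift_set E z `\` E.
have mEz : measurable (shift_set E z : set T) by exact: measurable_shift.
have mAB : measurable (A `|` B).
  by apply: measurableU; exact: measurableD.
have lB : lebo B <= (e / c / 2)%:E.
  have := lebesgue_outer_setD_shift z E (shift_set E (- z)%R).
  rewrite (_ : shift_set (shift_set E (- z)%R) z = E); last first.
    by apply/seteqP; split => x; rewrite /shift_set/= addrK.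
  by rewrite -/B => ->; apply: Erho; rewrite enormN.
apply: (@le_trans _ _ (c%:E * \int[leb]_x (\1_(A `|` B) x)%:E)).
  apply: ge0_integral_le_scale => // x _.
    by rewrite lee_fin powR_ge0.
  rewrite -EFinM lee_fin !indicE.
  have [ABx|ABx] := boolP (x \in A `|` B).
    rewrite mulr1; apply: (@le_trans _ _ (enorm w `^ q)%R); last by rewrite lerDl.
    apply: (ge0_ler_powR q0); rewrite ?nnegrE ?enorm_ge0//.
    rewrite -scalerBl enormZ ler_piMl ?enorm_ge0//.
    by case: (_ \in _); case: (_ \in _); rewrite ?subrr ?subr0 ?sub0r ?normrN ?normr0 ?normr1.
  rewrite mulr0 (_ : (x + z)%R \in E = (x \in E)) ?subrr ?enorm0 ?powR0//.
  apply/idP/idP; rewrite !inE => Ex; apply: contrapT => nEx; move/negP : ABx; apply.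
    by rewrite inE; right; split.
  by rewrite inE; left; split.
rewrite integral_indic// setIT -lee_pdivlMl//.
apply: le_trans (lebesgue_outerU A B) _.
apply: le_trans (leeD (Erho z zrho) lB) _.
rewrite -EFinD -EFinM lee_fin le_eqVlt; apply/orP; left; apply/eqP.
by field; rewrite gt_eqF.
Qed.

Lemma shift_continuous_sum (I : eqType) (s : seq I) (F : I -> V -> W) :
  (forall i, i \in s -> shift_continuous q (F i)) ->
  shift_continuous q (fun x => \sum_(i <- s) F i x)%R.
Proof.
elim: s => [_|i s IH Fs].
  rewrite (_ : (fun _ => _) = (fun x : V => (\1_(set0 : set T) x : R) *: (0 : W))%R).
    by apply: shift_continuous_indic => //; rewrite outer_measure0.
  by apply/funext => x; rewrite big_nil scaler0.
rewrite (_ : (fun _ => _) = (fun x => F i x + \sum_(j <- s) F j x)%R).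
  apply: shift_continuousD => //; first by apply: Fs; rewrite mem_head.
  by apply: IH => j js; apply: Fs; rewrite in_cons js orbT.
by apply/funext => x; rewrite big_cons.
Qed.

Lemma shift_continuous_nnsfun (h : {nnsfun T >-> R}) (w : W) :
  (forall c, c != 0%R -> lebo (h @^-1` [set c]) < +oo) ->
  shift_continuous q (fun x : V => h x *: w)%R.
Proof.
move=> hfin.
rewrite (_ : (fun _ => _) = (fun x => \sum_(c <- finmap.enum_fset (fset_set (range h)))
    (c * \1_(h @^-1` [set c]) x) *: w)%R); last first.
  by apply/funext => x; rewrite (fimfunE h x) fsbig_finite//= scaler_suml.
apply: shift_continuous_sum => c _.
have [->|c0] := eqVneq c 0%R.
  rewrite (_ : (fun _ => _) = (fun x : V => (\1_(set0 : set T) x : R) *: (0 : W))%R).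
    by apply: shift_continuous_indic => //; rewrite outer_measure0.
  by apply/funext => x; rewrite mul0r scale0r scaler0.
rewrite (_ : (fun _ => _) = (fun x : V => (\1_(h @^-1` [set c]) x : R) *: (c *: w))%R).
  by apply: shift_continuous_indic => //; exact: hfin.
by apply/funext => x; rewrite scalerA mulrC.
Qed.

(** The increasing approximation of f by simple functions converges in L^q by
    dominated convergence, and the nonzero levels of a simple function below f
    have finite measure by Chebyshev's inequality. *)
Lemma shift_continuous_nonneg (f : T -> R) (w : W) : enorm w = 1%R ->
  measurable_fun [set: T] f -> (forall x, 0 <= f x)%R ->
  \int[leb]_x (f x `^ q)%:E < +oo ->
  shift_continuous q (fun x : V => f x *: w)%R.
Proof.
move=> w1 mf f0 ffin.
apply: (shift_continuous_approx q1 (measurable_on_scale w mf)).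
have mEf : measurable_fun [set: T] (EFin \o f) by exact/measurable_EFinP.
have Ef0 x : setT x -> 0 <= (EFin \o f) x by rewrite lee_fin.
pose h k := nnsfun_approx measurableT mEf k.
have hf k x : (h k x <= f x)%R.
  by rewrite -lee_fin /h nnsfun_approxE; exact: (le_approx k Ef0).
have mfq : measurable_fun [set: T] (fun x => f x `^ q)%R.
  exact: (measurableT_comp (measurable_powR q) mf).
have hfin k c : c != 0%R -> lebo (h k @^-1` [set c]) < +oo.
  move=> c0; have mE : measurable (h k @^-1` [set c]) by exact: measurable_sfunP.
  have [->|/set0P[x hx]] := eqVneq (h k @^-1` [set c]) set0.
    by rewrite outer_measure0.
  have {}c0 : (0 < c)%R by rewrite lt_neqAle eq_sym c0 -hx fun_ge0.
  have cq0 : (0 < c `^ q)%R by rewrite powR_gt0.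
  have : (c `^ q)%:E * leb (h k @^-1` [set c]) <= \int[leb]_x (f x `^ q)%:E.
    apply: ge0_integral_mul_set => // [|y _|y hy].
    - exact: ltW.
    - by rewrite lee_fin powR_ge0.
    - rewrite lee_fin; apply: (ge0_ler_powR q0); rewrite ?nnegrE ?(ltW c0)//.
      by rewrite -hy.
  rewrite -lee_pdivlMl// => /le_lt_trans; apply.
  by rewrite lte_mul_pinfty// lee_fin invr_ge0 ltW.
have cvgh x : (h k x) @[k --> \oo] --> f x.
  have := @cvg_nnsfun_approx _ T R setT measurableT _ mEf Ef0 x I.
  by move/fine_cvg.
have cvgq : \int[leb]_x ((f x - h k x) `^ q)%:E @[k --> \oo] --> 0.
  have -> : 0 = \int[leb]_x (cst 0 x) by rewrite integral0.
  apply: (@dominated_cvg _ T R leb setT measurableT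
    (fun k x => ((f x - h k x) `^ q)%:E) (cst 0) (fun x => (f x `^ q)%:E)).
  - move=> k; apply/measurable_EFinP.
    apply: (measurableT_comp (measurable_powR q)).
    by apply: measurable_funB => //; exact: measurable_funPT.
  - move=> x _; apply: cvg_EFin; first exact: nearW.
    apply/cvgr0Pnorm_lt => e e0.
    have me0 : (0 < Num.min e 1)%R by rewrite lt_min e0/=.
    have /cvgrPdist_lt/(_ _ me0) := cvgh x; apply: filterS => k.
    rewrite lt_min => /andP[he h1] /=.
    have := hf k x; rewrite le_eqVlt => /predU1P[->|hlt].
      by rewrite subrr powR0// normr0.
    rewrite gtr0_norm ?subr_gt0// in he h1.
    rewrite ger0_norm ?powR_ge0//; apply: le_lt_trans he.
    by apply: ge1r_powR => //; rewrite subr_gt0 hlt/= ltW.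
  - by move=> x _.
  - apply/integrableP; split; first exact/measurable_EFinP.
    apply: le_lt_trans ffin; rewrite le_eqVlt; apply/orP; left; apply/eqP.
    by apply: eq_integral => x _; rewrite gee0_abs// lee_fin powR_ge0.
  - move=> k x _; rewrite gee0_abs ?lee_fin ?powR_ge0//.
    by apply: (ge0_ler_powR q0); rewrite ?nnegrE ?subr_ge0// lerBlDr lerDl.
move=> e e0.
have [k _ /(_ k (leqnn k)) /= ke] : \forall k \near \oo,
    \int[leb]_x ((f x - h k x) `^ q)%:E < e%:E.
  by apply: (cvgq [set y | y < e%:E]); apply: (@open_ereal_lt' _ 0 e%:E); rewrite lte_fin.
exists (fun x => h k x *: w)%R.
  by apply: shift_continuous_nnsfun => c; exact: hfin.
apply: le_trans (ltW ke); rewrite le_eqVlt; apply/orP; left; apply/eqP.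
apply: eq_integral => x _; rewrite -scalerBl enormZ w1 mulr1 ger0_norm//.
by rewrite subr_ge0.
Qed.

(** Splitting u into the positive and negative parts of its coordinates reduces to
    nonnegative scalar functions times a fixed unit vector. *)
Theorem Lq_shift_continuous (u : V -> W) : measurable_on setT u ->
  Lq_pow q u < +oo -> shift_continuous q u.
Proof.
move=> mu ufin.
pose e (j : 'I_m) : W := delta_mx (0 : 'I_1)%R j.
have e1 j : enorm (e j) = 1%R.
  rewrite /enorm (bigD1 j)//= mxE !eqxx/= expr1n big1 ?addr0 ?sqrtr1// => i /negbTE ij.
  by rewrite mxE eqxx ij/= expr0n.
rewrite (_ : u = (fun x => \sum_j (Num.max (u x 0 j) 0 *: e j +
   Num.max (- u x 0 j) 0 *: (- e j)))%R); last first.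
  apply/funext => x; apply/rowP => i; rewrite summxE (bigD1 i)//= big1 ?addr0.
    rewrite !mxE !eqxx/=; rewrite /Num.max; do 2 case: ifPn; rewrite -?leNgt; lra.
  by move=> j /negbTE ji; rewrite !mxE eq_sym ji/= oppr0 !mulr0 addr0.
have fin (f : V -> R) : (forall x, 0 <= f x <= enorm (u x))%R ->
    \int[leb]_x (f x `^ q)%:E < +oo.
  move=> fu; apply: le_lt_trans ufin; apply: ge0_le_integral_nonmeasurable => x _.
    by rewrite lee_fin powR_ge0.
  rewrite lee_fin; have /andP[f0 fux] := fu x.
  by apply: (ge0_ler_powR q0); rewrite ?nnegrE ?enorm_ge0.
apply: shift_continuous_sum => j _; apply: (shift_continuousD q1).
  apply: (shift_continuous_nonneg (e1 j)).
  - by apply: measurable_maxr; [exact: mu|exact: measurable_cst].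
  - by move=> x; rewrite le_max lexx orbT.
  - apply: fin => x; rewrite le_max lexx orbT/= ge_max enorm_ge0 andbT.
    exact: le_trans (ler_norm _) (coord_le_enorm _ _).
have eN1 : enorm (- e j)%R = 1%R by rewrite enormN.
apply: (shift_continuous_nonneg eN1).
- apply: measurable_maxr; last exact: measurable_cst.
  by apply: measurable_funN; exact: mu.
- by move=> x; rewrite le_max lexx orbT.
- apply: fin => x; rewrite le_max lexx orbT/= ge_max enorm_ge0 andbT.
  by apply: le_trans (ler_norm _) _; rewrite normrN coord_le_enorm.
Qed.

End translation_continuity.

(** * Writing a basis vector as a sum of good unit vectors *)

Section sphere_decomposition.
Context (R : realType) (k : nat).
Local Notation V := 'rV[R]_k.+1.
Local Notation sphere := (@unit_sphere R k.+1).
Local Notation H := (@hausdorff_outer R k.+1 k).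
Implicit Types (i j : 'I_k.+1) (x y : V) (B : set V).

Definition basis_vector i : V := delta_mx 0 i.

Lemma basis_vectorE i j : basis_vector i 0 j = (j == i)%:R.
Proof. by rewrite mxE eqxx. Qed.

Lemma enorm_basis_vector i : enorm (basis_vector i) = 1.
Proof.
rewrite /enorm (bigD1 i)//= basis_vectorE eqxx expr1n big1 ?addr0 ?sqrtr1// => j /negbTE ji.
by rewrite basis_vectorE ji expr0n.
Qed.

Definition axis_reflection i x : V := (2 * x 0 i) *: basis_vector i - x.

Lemma axis_reflectionE i x j :
  axis_reflection i x 0 j = if j == i then x 0 i else - x 0 j.
Proof. by rewrite !mxE eqxx/=; case: eqP => [->|_] /=; ring. Qed.

Lemma axis_reflectionB i x y :
  axis_reflection i x - axis_reflection i y = axis_reflection i (x - y).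
Proof.
apply/rowP => j; rewrite [LHS]mxE [X in _ + X]mxE !axis_reflectionE !mxE.
by case: eqP => _; ring.
Qed.

Lemma enorm_axis_reflection i x : enorm (axis_reflection i x) = enorm x.
Proof.
apply: enorm_eq; apply: eq_bigr => j _; rewrite axis_reflectionE.
by case: eqP => [->//|_]; rewrite sqrrN.
Qed.

Lemma axis_reflectionK i : involutive (axis_reflection i).
Proof.
move=> x; apply/rowP => j; rewrite axis_reflectionE.
by case: eqP => [->|/eqP/negbTE ji]; rewrite axis_reflectionE ?eqxx// ji opprK.
Qed.

(** The scaling that keeps a vector on the sphere when its height s above the
    equator is changed to 1/2 - s. *)
Definition flip_scale (s : R) : R := Num.sqrt ((1 - (1 / 2 - s) ^+ 2) / (1 - s ^+ 2)).

(** Moves a unit vector along its meridian from the height s = x_i to 1/2 - s. *)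
Definition height_flip i x : V :=
  flip_scale (x 0 i) *: x + (1 / 2 - x 0 i - flip_scale (x 0 i) * x 0 i) *: basis_vector i.

Lemma height_flipE i x j : height_flip i x 0 j =
  if j == i then 1 / 2 - x 0 i else flip_scale (x 0 i) * x 0 j.
Proof. by rewrite !mxE eqxx/=; case: eqP => [->|_] /=; ring. Qed.

Lemma sqr_flip_scale s : 0 <= s <= 1 / 2 ->
  flip_scale s ^+ 2 * (1 - s ^+ 2) = 1 - (1 / 2 - s) ^+ 2.
Proof.
move=> /andP[s0 s1]; have d0 : 0 < 1 - s ^+ 2 by nra.
by rewrite sqr_sqrtr ?divfK ?gt_eqF// divr_ge0// ?(ltW d0)//; nra.
Qed.

Lemma flip_scale_bounds s : 0 <= s <= 1 / 2 -> 3 / 4 <= flip_scale s <= 2.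
Proof.
move=> s01; have := sqr_flip_scale s01; have := sqrtr_ge0 ((1 - (1 / 2 - s) ^+ 2) / (1 - s ^+ 2)).
rewrite -/(flip_scale s); move: (flip_scale s) => f f0 E.
have /andP[s0 s1] := s01.
have ff : 0 <= f ^+ 2 by exact: sqr_ge0.
have h1 : (1 / 2 - s) ^+ 2 <= 1 / 4 by nra.
have h2 : s ^+ 2 <= 1 / 4 by nra.
have l1 : 3 / 4 <= f ^+ 2.
  by have := mulr_ge0 ff (sqr_ge0 s); lra.
have l2 : f ^+ 2 <= 4 / 3.
  have : f ^+ 2 * s ^+ 2 <= f ^+ 2 * (1 / 4) by rewrite ler_wpM2l.
  by have := sqr_ge0 (1 / 2 - s); lra.
by apply/andP; split; nra.
Qed.

Lemma flip_scale_lipschitz s t : 0 <= s <= 1 / 2 -> 0 <= t <= 1 / 2 ->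
  `|flip_scale s - flip_scale t| <= 2 * `|s - t|.
Proof.
move=> s01 t01; have /andP[f1 f2] := flip_scale_bounds s01.
have /andP[g1 g2] := flip_scale_bounds t01.
have Es := sqr_flip_scale s01; have Et := sqr_flip_scale t01.
move: (flip_scale s) (flip_scale t) f1 f2 g1 g2 Es Et => f g f1 f2 g1 g2 Es Et.
have /andP[s0 s1] := s01; have /andP[t0 t1] := t01.
have E : (f - g) * ((f + g) * (1 - s ^+ 2) * (1 - t ^+ 2)) =
    (s - t) * (1 - (s + t) / 4 + s * t).
  transitivity ((f ^+ 2 * (1 - s ^+ 2)) * (1 - t ^+ 2) - (g ^+ 2 * (1 - t ^+ 2)) * (1 - s ^+ 2)).
    by ring.
  by rewrite Es Et; field.
have ds : 3 / 4 <= 1 - s ^+ 2 by nra.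
have dt : 3 / 4 <= 1 - t ^+ 2 by nra.
have D : 27 / 32 <= (f + g) * (1 - s ^+ 2) * (1 - t ^+ 2).
  move: (1 - s ^+ 2) (1 - t ^+ 2) ds dt => a b ds dt.
  have : 9 / 16 <= a * b by nra.
  by rewrite -mulrA; move: (a * b) => ab; nra.
have N : `|1 - (s + t) / 4 + s * t| <= 5 / 4.
  by rewrite ler_norml; apply/andP; split; nra.
move: ((f + g) * _ * _) D E => d D /(congr1 Num.norm).
rewrite !normrM (ger0_norm (x := d)); last lra.
move=> E.
have := normr_ge0 (f - g); have := normr_ge0 (s - t); nra.
Qed.

Definition low_band i : set V := [set x | sphere x /\ 0 <= x 0 i <= 1 / 2].

Lemma height_flip_low_band i x : low_band i x -> low_band i (height_flip i x).
Proof.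
move=> [Sx x01]; split; last first.
  by rewrite height_flipE eqxx; have /andP[x0 x1] := x01; apply/andP; split; lra.
have Sx2 := sqr_enorm x; rewrite Sx expr1n (bigD1 i)//= in Sx2.
rewrite /unit_sphere/= /enorm (bigD1 i)//= height_flipE eqxx.
rewrite (eq_bigr (fun j => flip_scale (x 0 i) ^+ 2 * x 0 j ^+ 2)); last first.
  by move=> j /negbTE ji; rewrite height_flipE ji exprMn.
rewrite -mulr_sumr (_ : \sum_(j < _ | _) _ = 1 - x 0 i ^+ 2); last first.
  by rewrite Sx2; ring.
by rewrite sqr_flip_scale// addrC subrK sqrtr1.
Qed.

Lemma flip_scaleK s : 0 <= s <= 1 / 2 -> flip_scale (1 / 2 - s) * flip_scale s = 1.
Proof.
move=> s01; have /andP[s0 s1] := s01.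
have a0 : 0 < 1 - s ^+ 2 by nra.
have b0 : 0 < 1 - (1 / 2 - s) ^+ 2 by nra.
rewrite /flip_scale (_ : 1 / 2 - (1 / 2 - s) = s); last by ring.
rewrite -sqrtrM; last by rewrite divr_ge0 ?ltW.
by rewrite mulrA divfK ?gt_eqF// divff ?gt_eqF// sqrtr1.
Qed.

Lemma height_flipK i x : low_band i x -> height_flip i (height_flip i x) = x.
Proof.
move=> [_ x01]; apply/rowP => j; rewrite height_flipE [height_flip i x 0 i]height_flipE eqxx.
case: eqP => [->|/eqP/negbTE ji]; first by ring.
by rewrite height_flipE ji mulrA flip_scaleK// mul1r.
Qed.

Lemma height_flip_lipschitz i x y : low_band i x -> low_band i y ->
  enorm (height_flip i x - height_flip i y) <= 9 * enorm (x - y).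
Proof.
move=> [Sx x01] [Sy y01].
have xy := coord_le_enorm (x - y) i; rewrite !mxE in xy.
have fl := flip_scale_lipschitz x01 y01.
have /andP[f1 f2] := flip_scale_bounds x01.
have fl' : `|flip_scale (x 0 i) - flip_scale (y 0 i)| <= 2 * enorm (x - y).
  by apply: le_trans fl _; rewrite ler_wpM2l.
have -> : height_flip i x - height_flip i y = flip_scale (x 0 i) *: (x - y) +
    (flip_scale (x 0 i) - flip_scale (y 0 i)) *: y +
    ((y 0 i - x 0 i) + (flip_scale (x 0 i) * (y 0 i - x 0 i)
      + (flip_scale (y 0 i) - flip_scale (x 0 i)) * y 0 i)) *: basis_vector i.
  by apply/rowP => j; rewrite !mxE; case: (_ && _) => /=; ring.
have /andP[y0 y1] := y01.
have d0 := enorm_ge0 (x - y).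
have sc : `|flip_scale (x 0 i)| <= 2 by rewrite ger0_norm//; lra.
(* The scaling is at most 2 and is 2-Lipschitz in the height: 4 bounds its effect
   on the vector, and 5 = 1 + 2 + 2 the correction of the height. *)
apply: le_trans (enormD _ _) _.
rewrite (_ : 9 * _ = 4 * enorm (x - y) + 5 * enorm (x - y)); last by ring.
apply: lerD.
  apply: le_trans (enormD _ _) _; rewrite !enormZ Sy mulr1.
  rewrite (_ : 4 * _ = 2 * enorm (x - y) + 2 * enorm (x - y)); last by ring.
  by apply: lerD => //; rewrite ler_wpM2r.
rewrite enormZ enorm_basis_vector mulr1.
rewrite (_ : 5 * _ = enorm (x - y) + (2 * enorm (x - y) + 2 * enorm (x - y))); last by ring.
apply: le_trans (ler_normD _ _) _; apply: lerD; first by rewrite distrC.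
apply: le_trans (ler_normD _ _) _; rewrite !normrM; apply: lerD.
  by apply: ler_pM => //; rewrite distrC.
rewrite distrC -[leRHS]mulr1; apply: ler_pM => //.
by rewrite ger0_norm//; lra.
Qed.

Lemma height_flip_sum i x :
  x + axis_reflection i x + (height_flip i x + axis_reflection i (height_flip i x)) =
  basis_vector i.
Proof.
apply/rowP => j; rewrite [LHS]mxE [X in X + _]mxE [X in _ + X]mxE basis_vectorE.
by rewrite !axis_reflectionE !height_flipE eqxx; case: eqP => [->|_] /=; field.
Qed.

Local Open Scope ereal_scope.

Lemma axis_reflection_sphere i x : sphere x -> sphere (axis_reflection i x).
Proof. by rewrite /unit_sphere/= enorm_axis_reflection. Qed.

Lemma hausdorff_axis_reflection i A B :
  (forall x, A x -> B (axis_reflection i x)) -> H A <= H B.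
Proof.
move=> AB; rewrite -[leRHS]mul1e -(expr1n R k).
apply: (@hausdorff_lipschitz_image R _ _ k 1 B A (axis_reflection i)) => // [x y _ _|x Ax].
  by rewrite axis_reflectionB enorm_axis_reflection mul1r.
by exists (axis_reflection i x); [exact: AB|rewrite axis_reflectionK].
Qed.

Lemma hausdorff_height_flip i A B : A `<=` low_band i ->
  (forall x, A x -> B (height_flip i x)) -> H A <= (9 ^+ k)%:E * H B.
Proof.
move=> Ab AB; apply: (@le_trans _ _ ((9 ^+ k)%:E * H (B `&` low_band i))).
  apply: (@hausdorff_lipschitz_image R _ _ k 9 (B `&` low_band i) A (height_flip i)).
  - by [].
  - by move=> x y [_ Px] [_ Py]; exact: height_flip_lipschitz.
  move=> x Ax.
  exists (height_flip i x); last by rewrite height_flipK//; exact: Ab.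
  by split; [exact: AB|apply: height_flip_low_band; exact: Ab].
rewrite lee_wpmul2l ?lee_fin ?exprn_ge0//.
by apply: le_hausdorff => x [].
Qed.

(** A basis vector is a sum of at most four unit vectors avoiding any prescribed
    set of small surface measure.  In dimension one the two points of the sphere
    have positive measure and the vector itself will do.  Otherwise x, its mirror
    image in the axis i and the same pair at the complementary height add up to
    the basis vector, and each of the four conditions on x excludes a set of
    measure controlled by that of B. *)
Lemma sphere_decomposition : exists2 c : R, (0 < c)%R &
  forall i B, H B < c%:E -> exists s : seq V,
    [/\ (size s <= 4)%N, forall x, x \in s -> sphere x /\ ~ B x &
        basis_vector i = \sum_(x <- s) x]%R.
Proof.
(* The cap around another axis of half-width a lies in the band 0 <= x_i <= 1/2. *)
pose a : R := (k.+1%:R^-1)%R.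
have a0 : (0 < a)%R by rewrite invr_gt0.
have ka : (k%:R * a ^+ 2 <= 1)%R.
  rewrite expr2 mulrA -[leRHS](mulVf (_ : k.+1%:R != 0 :> R)%R) ?pnatr_eq0//.
  rewrite -/a mulrC ler_wpM2l ?(ltW a0)//.
  have : (a <= 1)%R by rewrite invf_le1// ler1n.
  by have := ler0n R k; rewrite -natr1; nra.
pose c0 := (unit_ball_volume R k * (a / 4) ^+ k)%R.
have c00 : (0 < c0)%R.
  by rewrite mulr_gt0 ?exprn_gt0 ?divr_gt0// (unit_ball_volume_gt0 R k).1.
have cap j : c0%:E <= H (sphere_cap j a) by exact: hausdorff_sphere_cap_gt0.
(* The four bad sets have total measure at most L times that of B. *)
pose L : R := (2 + 2 * 9 ^+ k)%R.
have L1 : (1 <= L)%R.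
  by have := exprn_ge0 k (ler0n R 9); rewrite /L; lra.
have L0 : (0 < L)%R by exact: lt_le_trans ltr01 L1.
exists (c0 / L)%R; first by rewrite divr_gt0.
move=> i B Bc.
have Bc0 : L%:E * H B < c0%:E by rewrite -lte_pdivlMl// -EFinM mulrC.
have [k0|k0] := posnP k.
  have [x [capx nBx]] : exists x, sphere_cap i a x /\ ~ B x.
    apply: contrapT => /forallNP nx; have : H (sphere_cap i a) <= H B.
      by apply: le_hausdorff => x cx; apply: contrapT => nB; apply: (nx x).
    move=> capB; have := le_lt_trans (le_trans (cap i) capB) Bc.
    by rewrite lte_fin ltNge ler_pdivrMr// ler_peMr// ltW.
  have all0 (j l : 'I_k.+1) : j = l.
    have zero (o : 'I_k.+1) : val o = 0%N.
      by have := ltn_ord o; rewrite [X in (_ < X.+1)%N]k0 ltnS leqn0 => /eqP.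
    by apply/val_inj; rewrite !zero.
  exists [:: x]; split => //.
    by move=> y; rewrite inE => /eqP->; split => //; case: capx.
  rewrite big_seq1; apply/rowP => j; rewrite basis_vectorE.
  have ji : j = i.
    by rewrite (all0 j i).
  rewrite ji eqxx; have [Sx xi _] := capx.
  move: Sx; rewrite /unit_sphere/= /enorm (bigD1 i)//= big1 ?addr0.
    by rewrite sqrtr_sqr ger0_norm// => ->.
  by move=> l /eqP; case; exact: all0.
have [j ji] : exists j : 'I_k.+1, j != i.
  exists (lift i (Ordinal k0)); rewrite eq_sym; exact: neq_lift.
have a2 : (a <= 1 / 2)%R.
  by rewrite div1r lef_pV2 ?posrE// ler_nat ltnS.
have capP : sphere_cap j a `<=` low_band i.
  move=> x [Sx _ xl]; split => //.
  have [l ->] : exists l, i = lift j l by case: (unlift_some ji) => l ? _; exists l.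
  by have /andP[-> xa] := xl l; exact: le_trans xa a2.
have [x [Px [nB1 [nB2 [nB3 nB4]]]]] : exists x, low_band i x /\
    (~ B x /\ (~ B (axis_reflection i x) /\ (~ B (height_flip i x) /\
     ~ B (axis_reflection i (height_flip i x))))).
  apply: contrapT => /forallNP nx; have := cap j; rewrite leNgt => /negP; apply.
  apply: le_lt_trans Bc0.
  pose B1 := [set x | low_band i x /\ B x].
  pose B2 := [set x | low_band i x /\ B (axis_reflection i x)].
  pose B3 := [set x | low_band i x /\ B (height_flip i x)].
  pose B4 := [set x | low_band i x /\ B (axis_reflection i (height_flip i x))].
  have H1 : H B1 <= H B by apply: le_hausdorff => x [].
  have H2 : H B2 <= H B by apply: (@hausdorff_axis_reflection i) => x [].
  have H3 : H B3 <= (9 ^+ k)%:E * H B.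
    by apply: (@hausdorff_height_flip i) => x [].
  have H4 : H B4 <= (9 ^+ k)%:E * H B.
    apply: (@le_trans _ _ ((9 ^+ k)%:E * H [set y | B (axis_reflection i y)])).
      by apply: (@hausdorff_height_flip i) => x [].
    rewrite lee_wpmul2l ?lee_fin ?exprn_ge0//.
    exact: (@hausdorff_axis_reflection i).
  apply: (@le_trans _ _ (H (B1 `|` B2 `|` (B3 `|` B4)))).
    apply: le_hausdorff => x /capP Px; apply: contrapT => nBx; apply: (nx x).
    by do ![split => //] => Bx; apply: nBx;
      [left; left|left; right|right; left|right; right].
  apply: le_trans (outer_measureU2 _ _ _) _.
  apply: le_trans (leeD (outer_measureU2 _ _ _) (outer_measureU2 _ _ _)) _.
  apply: le_trans (leeD (leeD H1 H2) (leeD H3 H4)) _.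
  have HB0 := hausdorff_ge0 k B.
  have HBf : H B \is a fin_num by rewrite ge0_fin_numE// (lt_trans Bc)// ltry.
  rewrite -(fineK HBf) -!EFinM -!EFinD lee_fin le_eqVlt; apply/orP; left.
  by apply/eqP; rewrite /L; ring.
exists [:: x; axis_reflection i x; height_flip i x;
           axis_reflection i (height_flip i x)]; split => //; last first.
  by rewrite !big_cons big_nil addr0 -(height_flip_sum i x) !addrA.
have [Sx _] := Px; have [Sf _] := height_flip_low_band Px.
move=> y; rewrite !inE => /or4P[] /eqP->; split => //.
  exact: axis_reflection_sphere.
exact: axis_reflection_sphere.
Qed.

End sphere_decomposition.

(** * Upper limits at zero, distances and measurable sets on the sphere *)

Lemma limf_esup_right_ltyP (R : realType) (F : R -> \bar R) :
  (limf_esup F (0 : R)^'+ < +oo)%E <->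
  exists d M : R, [/\ 0 < d, 0 <= M & forall t, 0 < t < d -> (F t <= M%:E)%E].
Proof.
split=> [/ereal_inf_lt[_ [V V0 <-] supV]|[d [M [d0 M0 FM]]]].
  have [e /= e0 eV] := V0.
  have Fsup t : 0 < t < e -> (F t <= ereal_sup [set F x | x in V])%E.
    move=> /andP[t0 te]; apply: ereal_sup_ubound; exists t => //.
    by apply: eV => //=; rewrite sub0r normrN gtr0_norm.
  move: (ereal_sup _) supV Fsup => [s _ Fs|//|_ Fs].
    exists e, (Num.max s 0); split => //; first by rewrite le_max lexx orbT.
    by move=> t /Fs /le_trans; apply; rewrite lee_fin le_max lexx.
  by exists e, 0; split => // t /Fs /le_trans; apply; exact: leNye.
apply: le_lt_trans (ltry M).
apply: (@le_trans _ _ (ereal_sup [set F x | x in [set t | 0 < t < d]])).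
  apply: ereal_inf_lbound; exists [set t | 0 < t < d] => //.
  exists d => //= t; rewrite /= sub0r normrN => td t0.
  by rewrite t0/= (le_lt_trans (ler_norm t)).
by apply: ge_ereal_sup => _ [t /FM tM <-].
Qed.

Section distance_to_set.
Context (R : realType) (n : nat).
Implicit Types (B : set 'rV[R]_n) (x y : 'rV[R]_n).

Definition infdist B x : R := inf [set enorm (x - b) | b in B].

Let dist_lb B x : has_lbound [set enorm (x - b) | b in B].
Proof. by exists 0 => _ [b _ <-]; exact: enorm_ge0. Qed.

Let dist_neq0 B x : B !=set0 -> [set enorm (x - b) | b in B] !=set0.
Proof. by move=> [b Bb]; exists (enorm (x - b)); exists b. Qed.

Lemma infdist_le B x b : B b -> infdist B x <= enorm (x - b).
Proof. by move=> Bb; apply: ge_inf => //; exists b. Qed.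

Lemma infdist_ge0 B x : B !=set0 -> 0 <= infdist B x.
Proof.
move=> B0; apply: lb_le_inf; first exact: dist_neq0.
by move=> _ [b _ <-]; exact: enorm_ge0.
Qed.

Lemma infdist_lipschitz B x y : B !=set0 ->
  infdist B x - infdist B y <= enorm (x - y).
Proof.
move=> B0; rewrite lerBlDr -lerBlDl; apply: lb_le_inf; first exact: dist_neq0.
move=> _ [b Bb <-]; rewrite lerBlDl; apply: le_trans (infdist_le x Bb) _.
exact: enorm_triangle.
Qed.

Lemma infdist_lt B x (rho : R) : B !=set0 -> infdist B x < rho ->
  exists2 b, B b & enorm (x - b) < rho.
Proof.
move=> B0 xr; have infE : has_inf [set enorm (x - b) | b in B].
  by split => //; exact: dist_neq0.
have := inf_adherent (_ : 0 < rho - infdist B x) infE.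
rewrite subr_gt0 => /(_ xr)[_ [b Bb <-]]; rewrite -/(infdist B x) [ltRHS]addrC subrK => xb.
by exists b.
Qed.

Definition near_set B (rho : R) : set 'rV[R]_n :=
  [set x | exists2 b, B b & enorm (x - b) < rho].

End distance_to_set.

Section hausdorff_sets.
Context (R : realType) (n k : nat).
Local Notation H := (hausdorff R n k).
Local Notation T := (hausdorffType R n k).

Lemma measurable_hausdorff_le0 (g : 'rV[R]_n -> R) :
  (forall x y, g x - g y <= enorm (x - y)) ->
  measurable ([set x | g x <= 0] : set T).
Proof. by move=> gL; exact: (@hausdorff_caratheodory R n k g gL). Qed.

Lemma measurable_unit_sphere : measurable (@unit_sphere R n : set T).
Proof.
rewrite (_ : @unit_sphere R n =
    [set x | enorm x - 1 <= 0] `&` [set x | 1 - enorm x <= 0]).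
  apply: measurableI; apply: measurable_hausdorff_le0 => x y.
    rewrite (_ : _ - (_ - _) = enorm x - enorm y); last by ring.
    exact: le_trans (ler_norm _) (ler_enormB _ _).
  rewrite (_ : _ - (_ - _) = enorm y - enorm x); last by ring.
  rewrite enormB; exact: le_trans (ler_norm _) (ler_enormB _ _).
apply/seteqP; split => x /=; rewrite /unit_sphere/=.
  by move=> ->; rewrite subrr.
by move=> []; rewrite !subr_le0 => a b; apply/eqP; rewrite eq_le a.
Qed.

Lemma measurable_near_set B rho : measurable (near_set B rho : set T).
Proof.
have [->|/set0P B0] := eqVneq B set0.
  rewrite (_ : near_set _ _ = set0)//.
  by apply/seteqP; split => x // -[].
rewrite (_ : near_set B rho = ~` [set x | rho - infdist B x <= 0]).
  apply: measurableC; apply: measurable_hausdorff_le0 => x y.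
  rewrite (_ : _ - (_ - _) = infdist B y - infdist B x); last by ring.
  by rewrite enormB infdist_lipschitz.
apply/seteqP; split => x /=.
  move=> [b Bb xb] /=; rewrite subr_le0 leNgt => /negP; apply.
  exact: le_lt_trans (infdist_le x Bb) xb.
move=> /negP; rewrite -ltNge subr_gt0; exact: infdist_lt.
Qed.

End hausdorff_sets.

(** * From the average over the sphere to every direction *)

Section sphere_energy_characterization.
Context (R : realType) (k m : nat) (q r : R).
Hypothesis q1 : 1 <= q.
Local Notation V := 'rV[R]_k.+1.
Local Notation W := 'rV[R]_m.
Local Notation leb := (lebesgue_rV R k.+1).
Local Notation HM := (hausdorff R k.+1 k).
Local Notation T := (hausdorffType R k.+1 k).
Local Notation sphere := (@unit_sphere R k.+1).
Local Open Scope ereal_scope.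
Implicit Types (u : V -> W) (z : V).

Let C : R := (2 `^ q)%R.
Let C1 : (1 <= C)%R. Proof. exact: powR2_ge1. Qed.
Let C0 : (0 < C)%R. Proof. exact: lt_le_trans ltr01 C1. Qed.

Lemma sphere_energyE u (t : R) : (0 < t)%R -> measurable_on setT u ->
  sphere_energy q r u t =
  \int[HM]_(n in sphere) ((t `^ r)^-1%:E * increment q u (t *: n)%R).
Proof.
move=> t0 mu; apply: eq_integral => n _.
by rewrite integral_increment_div// powR_gt0.
Qed.

Lemma increment_sum (s : seq V) u : measurable_on setT u ->
  increment q u (\sum_(z <- s) z)%R <=
  (C ^+ size s)%:E * \sum_(z <- s) increment q u z.
Proof.
move=> mu; elim: s => [|z s IH].
  by rewrite !big_nil increment0// mule0.
rewrite !big_cons /= exprS; apply: le_trans (increment_add q1 _ _ mu) _.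
rewrite -/C EFinM -muleA lee_pmul2l// ge0_muleDr ?increment_ge0 ?sume_ge0//; last first.
  by move=> y _; exact: increment_ge0.
apply: leeD => //; rewrite -[leLHS]mul1e; apply: lee_wpmul2r.
  exact: increment_ge0.
by rewrite lee_fin exprn_ege1.
Qed.

(** Chebyshev's inequality on the sphere.  The increments need not be measurable
    in the direction n, but their size changes by little under small changes of
    n, so that the bad directions have a measurable neighborhood on which the
    increments are still large. *)
Lemma large_increment_sphere u (t L M : R) : (0 < t)%R -> (0 <= L)%R ->
  shift_continuous q u -> sphere_energy q r u t <= M%:E ->
  L%:E * HM [set n | sphere n /\ (C * (L + 1) * t `^ r)%:E < increment q u (t *: n)%R]
    <= M%:E.
Proof.
move=> t0 L0 [mu cu]; rewrite sphere_energyE// => sM.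
set B := [set n | _].
have tr0 : (0 < t `^ r)%R by rewrite powR_gt0.
have [rho rho0 urho] := cu _ tr0.
apply: le_trans sM.
pose A : set T := near_set B (rho / t) `&` sphere.
apply: (@le_trans _ _ (L%:E * HM A)).
  rewrite lee_wpmul2l ?lee_fin//; apply: le_hausdorff => x Bx.
  split; last by case: Bx.
  by exists x => //; rewrite subrr enorm0 divr_gt0.
have mA : measurable A.
  have mN := @measurable_near_set R k.+1 k B (rho / t)%R.
  have mS := @measurable_unit_sphere R k.+1 k.
  exact: (measurableI _ _ mN mS).
apply: (@ge0_integral_mul_set _ T R HM sphere A _ L mA _ L0).
- by move=> x [].
- by move=> x _; rewrite mule_ge0 ?increment_ge0// lee_fin invr_ge0 ltW.
move=> x [[b [_ Bb] xb] _].
have tV0 : (0 < (t `^ r)^-1)%R by rewrite invr_gt0.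
rewrite -(lee_pdivrMl (increment q u (t *: x)%R) L%:E tV0).
rewrite invrK -EFinM.
have near_small : increment q u (t *: (b - x))%R <= (t `^ r)%:E.
  apply: urho; rewrite enormZ gtr0_norm// enormB mulrC -ltr_pdivlMr//.
have := increment_add q1 (t *: x)%R (t *: (b - x))%R mu.
rewrite -scalerDr addrC subrK => bx.
have {}bx : C%:E * ((L + 1) * t `^ r)%:E <
    C%:E * (increment q u (t *: x)%R + (t `^ r)%:E).
  rewrite -EFinM mulrA; apply: lt_le_trans Bb _; apply: le_trans bx _.
  by rewrite lee_pmul2l// leeD2l.
have Ce0 : 0 < C%:E by rewrite lte_fin.
have Cf : C%:E \is a fin_num by [].
have tf : (t `^ r)%:E \is a fin_num by [].
move: bx; rewrite (lte_pmul2l Cf Ce0) mulrDl mul1r EFinD => /ltW.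
by rewrite (leeD2rE _ _ tf) (mulrC L).
Qed.

(** With L as below the bad directions have measure less than the threshold c of the
    decomposition, and almost subadditivity bounds the increment along e_i by those
    along four good directions. *)
Lemma axis_increment_bound u (d M : R) : (0 < r)%R -> (0 < d)%R -> (0 <= M)%R ->
  shift_continuous q u ->
  (forall t, (0 < t < d)%R -> sphere_energy q r u t <= M%:E) ->
  exists2 D : R, (0 <= D)%R & forall (t : R) (i : 'I_k.+1), (0 < t < d)%R ->
    increment q u (t *: basis_vector R i)%R <= (D * t `^ r)%:E.
Proof.
move=> r0 d0 M0 cu sM; have [mu _] := cu.
have [c c0 dec] := sphere_decomposition R k.
pose L := ((M + 1) / c)%R.
have L0 : (0 < L)%R by rewrite divr_gt0// ltr_wpDl.
pose K := (C * (L + 1))%R.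
have K0 : (0 <= K)%R by rewrite mulr_ge0 ?addr_ge0 ?(ltW L0) ?(ltW C0).
have Ck j : (0 <= C ^+ j)%R by exact: exprn_ge0 (ltW C0).
exists (C ^+ 4 * (4 * K))%R.
  by apply: mulr_ge0; [exact: Ck|rewrite mulr_ge0].
move=> t i t0d; have /andP[t0 td] := t0d.
have tr0 : (0 < t `^ r)%R by rewrite powR_gt0.
pose B := [set n : V | sphere n /\ (K * t `^ r)%:E < increment q u (t *: n)%R].
have HB : hausdorff_outer k B < c%:E.
  have := large_increment_sphere t0 (ltW L0) cu (sM t t0d); rewrite -/K -/B.
  rewrite -lee_pdivlMl// => /le_lt_trans; apply.
  rewrite -EFinM lte_fin /L invf_div mulrAC ltr_pdivrMr ?ltr_wpDl//.
  by rewrite ltr_pM2l// ltrDl.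
have [s [s4 sB ->]] := dec i B HB.
rewrite scaler_sumr -[X in increment q u X](big_map (fun n => t *: n)%R xpredT idfun).
apply: le_trans (increment_sum _ mu) _; rewrite size_map big_map.
apply: (@le_trans _ _ ((C ^+ size s)%:E * ((size s)%:R * (K * t `^ r))%:E)).
  apply: lee_wpmul2l; first by rewrite lee_fin exprn_ge0// ltW.
  elim: s sB {s4} => [|n s IH] sB; first by rewrite big_nil mul0r.
  rewrite big_cons /= -natr1 mulrDl mul1r EFinD [leRHS]addeC; apply: leeD.
    have [Sn nB] := sB n (mem_head _ _); rewrite leNgt; apply/negP => Kn.
    exact: nB (conj Sn Kn).
  by apply: IH => y ys; apply: sB; rewrite in_cons ys orbT.
rewrite -EFinM lee_fin [leRHS](_ : _ = C ^+ 4 * (4 * (K * t `^ r)))%R; last by ring.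
move: (K * t `^ r)%R (mulr_ge0 K0 (ltW tr0)) => X X0; apply: ler_pM.
- exact: Ck.
- exact: mulr_ge0.
- by rewrite ler_weXn2l.
- by rewrite ler_wpM2r// (ler_nat R _ 4).
Qed.

(** Almost subadditivity again, for the decomposition of h along the axes. *)
Lemma increment_bound u (d M : R) : (0 < r)%R -> (0 < d)%R -> (0 <= M)%R ->
  shift_continuous q u ->
  (forall t, (0 < t < d)%R -> sphere_energy q r u t <= M%:E) ->
  exists2 D : R, (0 <= D)%R & forall h : V, (enorm h < d)%R ->
    increment q u h <= (D * enorm h `^ r)%:E.
Proof.
move=> r0 d0 M0 cu sM; have [mu _] := cu.
have [D D0 DM] := axis_increment_bound r0 d0 M0 cu sM.
exists (C ^+ k.+1 * (k.+1%:R * D))%R.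
  by apply: mulr_ge0; [exact: exprn_ge0 (ltW C0)|rewrite mulr_ge0].
move=> h hd.
pose s := [seq (h 0 i *: basis_vector R i)%R | i <- index_enum 'I_k.+1].
have hs : h = (\sum_(z <- s) z)%R.
  rewrite big_map; apply/rowP => j; rewrite summxE (bigD1 j)//= big1 ?addr0.
    by rewrite mxE basis_vectorE eqxx mulr1.
  by move=> i /negbTE ij; rewrite mxE basis_vectorE eq_sym ij mulr0.
have sz : size s = k.+1.
  by rewrite size_map /index_enum -enumT size_enum_ord.
rewrite {1}hs; apply: le_trans (increment_sum _ mu) _.
rewrite sz -mulrA EFinM; apply: lee_wpmul2l.
  by rewrite lee_fin; exact: exprn_ge0 (ltW C0).
apply: (@le_trans _ _ (\sum_(z <- s) (D * enorm h `^ r)%:E)).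
  rewrite big_map [leRHS]big_map; apply: lee_sum => i _.
  have hi := coord_le_enorm h i.
  have ei : (D * `|h 0%R i| `^ r <= D * enorm h `^ r)%R.
    by rewrite ler_wpM2l// ge0_ler_powR ?nnegrE ?enorm_ge0// ltW.
  have [hi0|hi0|hi0] := ltgtP (h 0%R i) 0%R.
  - rewrite -(opprK (h 0%R i)) scaleNr increment_opp//.
    apply: le_trans (DM _ i _) _; last by rewrite lee_fin -(ltr0_norm hi0).
    by rewrite oppr_gt0 hi0/= -(ltr0_norm hi0) (le_lt_trans hi).
  - apply: le_trans (DM _ i _) _; last by rewrite lee_fin -{1}(gtr0_norm hi0).
    by rewrite hi0/= -(gtr0_norm hi0) (le_lt_trans hi).
  - by rewrite hi0 scale0r increment0// lee_fin mulr_ge0// powR_ge0.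
by rewrite sumEFin big_const_seq count_predT sz iter_addr_0 lee_fin -mulrA [leRHS]mulr_natl.
Qed.

End sphere_energy_characterization.

(** * The Besov condition on the whole space *)

Section besov_increment.
Context (R : realType) (n m : nat) (q r : R).
Hypothesis q1 : 1 <= q.
Hypothesis r0 : 0 < r.
Local Notation V := 'rV[R]_n.
Local Notation W := 'rV[R]_m.
Local Notation leb := (lebesgue_rV R n).
Local Open Scope ereal_scope.
Implicit Types (u : V -> W) (h : V).

Let C : R := (2 `^ q)%R.
Let C1 : (1 <= C)%R. Proof. exact: powR2_ge1. Qed.
Let C0 : (0 < C)%R. Proof. exact: lt_le_trans ltr01 C1. Qed.
Let qgt0 : (0 < q)%R. Proof. exact: lt_le_trans ltr01 q1. Qed.

Lemma LqP u : Lq q u <-> measurable_on setT u /\ Lq_pow q u < +oo.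
Proof.
have E : 'N[leb]_q%:E[EFin \o (fun x => enorm (u x))] `^ q = Lq_pow q u.
  rewrite poweR_Lnorm; last by rewrite gt_eqF.
  apply: eq_integral => x _.
  by rewrite /= ger0_norm ?enorm_ge0.
rewrite /Lq /finite_norm -E; split=> -[mu fin]; split => //.
  exact: poweR_lty.
by apply: lty_poweRy fin; rewrite gt_eqF.
Qed.

Lemma integral_incrementE u h (t : R) : (0 < t)%R -> measurable_on setT u ->
  \int[leb]_x (enorm (u (x + h)%R - u x) `^ q / t `^ (r / q * q))%:E =
  (t `^ r)^-1%:E * increment q u h.
Proof.
move=> t0 mu; rewrite divfK ?gt_eqF// integral_increment_div//.
by rewrite powR_gt0.
Qed.

Lemma besov_increment_le u : besov q (r / q) u ->
  exists2 M : R, (0 <= M)%R & forall h (t : R), (0 < t)%R -> (enorm h <= t)%R ->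
    (t `^ r)^-1%:E * increment q u h <= M%:E.
Proof.
move=> [/LqP[mu ufin]]; set S := ereal_sup _ => Sfin.
have key h (t : R) : (0 < t)%R -> (enorm h <= t)%R ->
    (t `^ r)^-1%:E * increment q u h <= S.
  move=> t0 ht; rewrite -integral_incrementE//.
  apply: (@le_trans _ _ (ereal_sup
      [set \int[leb]_x (enorm (u (x + h)%R - u x) `^ q / t `^ (r / q * q))%:E
        | h in [set h : 'rV[R]_n | (enorm h <= t)%R]])).
    by apply: ereal_sup_ubound; exists h.
  by apply: ereal_sup_ubound; exists t.
have S0 : 0 <= S.
  by apply: le_trans (key 0%R 1%R _ _); rewrite ?enorm0// increment0// mule0.
exists (fine S); first exact: fine_ge0.
by move=> h t t0 ht; rewrite fineK ?ge0_fin_numE// key.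
Qed.

(** At distance at least d the L^q norm of u bounds the increments, and dividing by
    rho^r with rho >= d does no harm. *)
Lemma besov_of_increment u (d D : R) : Lq q u -> (0 < d)%R -> (0 <= D)%R ->
  (forall h, (enorm h < d)%R -> increment q u h <= (D * enorm h `^ r)%:E) ->
  besov q (r / q) u.
Proof.
move=> Lu d0 D0 uD; split => //; have /LqP[mu ufin] := Lu.
have Ef : Lq_pow q u \is a fin_num by rewrite ge0_fin_numE ?Lq_pow_ge0.
pose E := fine (Lq_pow q u); have E0 : (0 <= E)%R by rewrite fine_ge0 ?Lq_pow_ge0.
pose M := (D + (d `^ r)^-1 * (C * (E + E)))%R.
have dr0 : (0 < d `^ r)%R by rewrite powR_gt0.
have M2 : (0 <= (d `^ r)^-1 * (C * (E + E)))%R.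
  by apply: mulr_ge0; rewrite ?invr_ge0 ?mulr_ge0 ?addr_ge0 ?(ltW C0) ?(ltW dr0).
apply: le_lt_trans (ltry M); apply: ge_ereal_sup => _ [t /= t0 <-].
apply: ge_ereal_sup => _ [h /= ht <-]; rewrite integral_incrementE//.
have tr0 : (0 < t `^ r)%R by rewrite powR_gt0.
have it0 : 0 <= (t `^ r)^-1%:E :> \bar R by rewrite lee_fin invr_ge0 ltW.
have [hd|dh] := ltP (enorm h) d.
  apply: le_trans (lee_wpmul2l it0 (uD h hd)) _.
  rewrite -EFinM lee_fin; apply: (@le_trans _ _ D); last by rewrite lerDl.
  rewrite mulrCA ler_piMr// mulrC ler_pdivrMr// mul1r.
  by apply: ge0_ler_powR; rewrite ?nnegrE ?enorm_ge0// ltW.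
apply: le_trans (lee_wpmul2l it0 (increment_le_Lq_pow q1 h mu)) _.
rewrite -(fineK Ef) -/E -EFinD -!EFinM lee_fin.
apply: (@le_trans _ _ ((d `^ r)^-1 * (C * (E + E)))%R); last by rewrite lerDr.
apply: ler_wpM2r; first by rewrite mulr_ge0 ?addr_ge0 ?(ltW C0).
rewrite lef_pV2 ?posrE//; apply: ge0_ler_powR; rewrite ?nnegrE ?(ltW d0) ?(ltW t0) ?(ltW r0)//.
exact: le_trans dh ht.
Qed.

End besov_increment.

Section besov_sphere.
Context (R : realType) (k m : nat) (q r : R).
Hypothesis q1 : 1 <= q.
Hypothesis r0 : 0 < r.
Local Notation V := 'rV[R]_k.+1.
Local Notation W := 'rV[R]_m.
Local Notation HM := (hausdorff R k.+1 k).
Local Notation sphere := (@unit_sphere R k.+1).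
Local Open Scope ereal_scope.
Implicit Types (u : V -> W).

Lemma hausdorff_sphere_fin_num : HM sphere \is a fin_num.
Proof.
by rewrite ge0_fin_numE; [exact: hausdorff_sphere_lty|exact: hausdorff_ge0].
Qed.

Lemma besov_sphere_energy_le u : besov q (r / q) u ->
  exists2 M : R, (0 <= M)%R & forall t, (0 < t)%R -> sphere_energy q r u t <= M%:E.
Proof.
move=> uB; have [M M0 uM] := besov_increment_le q1 uB.
have [/(LqP q1)[mu _] _] := uB.
have Sf := hausdorff_sphere_fin_num.
have S0 : (0 <= fine (HM sphere))%R by rewrite fine_ge0; [|exact: hausdorff_ge0].
exists (M * fine (HM sphere))%R; first exact: mulr_ge0.
move=> t t0; rewrite sphere_energyE// EFinM fineK//.
rewrite -(integral_cst HM (@measurable_unit_sphere R k.+1 k) M%:E).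
apply: ge0_le_integral_nonmeasurable => x Sx.
  by rewrite mule_ge0 ?increment_ge0// lee_fin invr_ge0 powR_ge0.
by apply: uM => //; rewrite enormZ Sx mulr1 gtr0_norm.
Qed.

Lemma besov_of_sphere_energy u (d M : R) : Lq q u -> (0 < d)%R -> (0 <= M)%R ->
  (forall t, (0 < t < d)%R -> sphere_energy q r u t <= M%:E) ->
  besov q (r / q) u.
Proof.
move=> Lu d0 M0 uM; have /(LqP q1)[mu ufin] := Lu.
have [D D0 uD] := increment_bound q1 r0 d0 M0 (Lq_shift_continuous q1 mu ufin) uM.
exact: (besov_of_increment q1 r0 Lu d0 D0 uD).
Qed.

Theorem besov_sphere_energyP u : Lq q u ->
  besov q (r / q) u <-> limf_esup (sphere_energy q r u) (0 : R)^'+ < +oo.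
Proof.
move=> Lu; rewrite limf_esup_right_ltyP; split=> [/besov_sphere_energy_le[M M0 uM]|].
  by exists 1%R, M; split => // t /andP[t0 _]; exact: uM.
by move=> [d [M [d0 M0 uM]]]; exact: besov_of_sphere_energy Lu d0 M0 uM.
Qed.

End besov_sphere.

(** * Cutoff functions *)

Section cutoff.
Context (R : realType) (n : nat).
Local Notation V := 'rV[R]_n.
Implicit Types (K G U : set V) (x y : V).

Lemma lipschitz_continuous (f : V -> R) (L : R) :
  (forall x y, `|f x - f y| <= L * enorm (x - y)) -> continuous f.
Proof.
move=> fL x A /nbhs_ballP[e /= e0 eA].
pose c := (`|L| + 1) * (n%:R + 1); have c0 : 0 < c.
  by rewrite mulr_gt0// ltr_wpDl.
change (nbhs x (f @^-1` A)).
apply: filterS (nbhsx_ballx x (e / c) (divr_gt0 e0 c0)) => y.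
rewrite -ball_normE /= => xy; apply: eA; rewrite -ball_normE /=.
apply: le_lt_trans (fL x y) _.
apply: (@le_lt_trans _ _ (c * `|x - y|)); last by rewrite -ltr_pdivlMl// mulrC.
rewrite /c -mulrA; apply: (@le_trans _ _ ((`|L| + 1) * enorm (x - y))).
  rewrite ler_wpM2r ?enorm_ge0// (le_trans (ler_norm _))// lerDl.
  exact: ler01.
rewrite ler_wpM2l ?addr_ge0//; apply: le_trans (enorm_le_norm _) _.
by rewrite ler_wpM2r// lerDl.
Qed.

Lemma open_near_set K (rho : R) : open (near_set K rho).
Proof.
have [->|/set0P K0] := eqVneq K set0.
  rewrite (_ : near_set _ _ = set0); first exact: open0.
  by apply/seteqP; split => x // -[].
rewrite (_ : near_set K rho = infdist K @^-1` [set t | t < rho]); last first.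
  apply/seteqP; split => x /=; last exact: infdist_lt.
  by move=> [b Kb xb]; exact: le_lt_trans (infdist_le x Kb) xb.
apply: open_comp; last exact: open_lt.
move=> x _; apply: (@lipschitz_continuous _ 1) => {}x y.
rewrite mul1r ler_norml lerNl opprB enormB !infdist_lipschitz// enormB.
by rewrite infdist_lipschitz.
Qed.

(** The function max(0, 1 - dist(x, K) / d); the empty set needs a separate, zero
    cutoff since an infimum over it carries no information. *)
Lemma cutoff_exists K (d : R) : 0 < d -> exists eta : V -> R,
  [/\ forall x, 0 <= eta x <= 1, forall x, K x -> eta x = 1,
      forall x, eta x != 0 -> near_set K d x &
      forall x y, `|eta x - eta y| <= d^-1 * enorm (x - y)].
Proof.
move=> d0; have [->|/set0P K0] := eqVneq K set0.
  exists (fun=> 0); split => //.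
  - by move=> x; rewrite lexx ler01.
  - by move=> x; rewrite eqxx.
  - by move=> x y; rewrite subrr normr0 mulr_ge0 ?enorm_ge0// invr_ge0 ltW.
exists (fun x => Num.max 0 (1 - d^-1 * infdist K x)).
have dV0 : 0 <= d^-1 by rewrite invr_ge0 ltW.
have D0 x : 0 <= infdist K x by exact: infdist_ge0.
split.
- move=> x; rewrite le_max lexx/= ge_max ler01/= lerBlDr lerDl.
  by rewrite mulr_ge0.
- move=> x Kx; have -> : infdist K x = 0.
    apply/eqP; rewrite eq_le D0 andbT -(enorm0 R n) -(subrr x).
    exact: infdist_le.
  by rewrite mulr0 subr0 max_r ?ler01.
- move=> x; rewrite /near_set/= => e0; apply: infdist_lt => //.
  rewrite ltNge; apply: contra e0 => dK; apply/eqP/max_l.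
  by rewrite subr_le0 -(mulVf (lt0r_neq0 d0)) ler_wpM2l.
- move=> x y; apply: (@le_trans _ _ (d^-1 * `|infdist K x - infdist K y|)).
    rewrite [leRHS](_ : _ = `|d^-1 * infdist K x - d^-1 * infdist K y|); last first.
      by rewrite -mulrBr normrM (ger0_norm dV0).
    move: (d^-1 * infdist K x) (d^-1 * infdist K y) => a b.
    have := ler_norm (a - b); have := ler_norm (b - a); have := normr_ge0 (a - b).
    rewrite (distrC b a) ler_norml; move: (`|a - b|) => N N0 n1 n2.
    rewrite !maxElt; case: (ltP 0 (1 - a)) => h1; case: (ltP 0 (1 - b)) => h2;
      by apply/andP; split; lra.
  rewrite ler_wpM2l// ler_norml lerNl opprB enormB infdist_lipschitz//=.
  by rewrite enormB infdist_lipschitz.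
Qed.

(** By compactness a single radius e works at all points of K; halving it keeps the
    closure of the neighborhood inside. *)
Lemma near_set_compactly_inside K U : compact K -> open U -> K `<=` U ->
  exists2 d : R, 0 < d & compactly_inside (near_set K d) U.
Proof.
move=> cK oU KU.
have [e e0 Ke] : exists2 e : R, 0 < e & forall x, K x -> ball x e `<=` U.
  have /compact_near_coveringP/(_ R (0 : R)^'+ (fun e x => ball x e `<=` U)) := cK.
  move=> /(_ _ _)[|e0 /= e00 eU].
    move=> x Kx; have /nbhs_ballP[d /= d0 dU] : nbhs x U.
      by apply: open_nbhs_nbhs; split => //; exact: KU.
    exists (ball x (d / 2), [set e | 0 < e < d / 2]).
      split; first by apply: nbhsx_ballx; rewrite divr_gt0.
      exists (d / 2); first by rewrite /= divr_gt0.
      move=> t /=; rewrite sub0r normrN => td t0.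
      by rewrite t0/= (le_lt_trans (ler_norm t)).
    move=> [y t] [/= xy /andP[t0 td]] z yz; apply: dU.
    rewrite (splitr d); apply: ball_triangle xy _.
    exact: le_ball (ltW td) _ yz.
  exists (e0 / 2); first by rewrite divr_gt0.
  move=> x Kx; apply: eU => //=; last by rewrite divr_gt0.
  rewrite sub0r normrN gtr0_norm ?divr_gt0// gtr_pMr// invf_lt1 ?ltr1n//.
have near_close x : closure (near_set K (e / 2)) x -> exists2 b, K b & `|b - x| < e.
  move=> /(_ (ball x (e / 2))) []; first by apply: nbhsx_ballx; rewrite divr_gt0.
  move=> y [[b Kb yb] xy]; exists b => //.
  rewrite (splitr e) -(subrKA y); apply: le_lt_trans (ler_normD _ _) _.
  apply: ltrD; first by rewrite distrC (le_lt_trans (norm_le_enorm _)).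
  by move: xy; rewrite -ball_normE/= distrC.
exists (e / 2); first by rewrite divr_gt0.
split; last first.
  by move=> x /near_close[b Kb bx]; apply: (Ke b Kb); rewrite -ball_normE.
apply: bounded_closed_compact; last exact: closed_closure.
have [M [Mr KM]] := compact_bounded cK.
exists (M + 1 + e); split; first exact: num_real.
move=> t Mt x /near_close[b Kb bx].
apply: ltW; apply: le_lt_trans Mt; rewrite -(subrK b x).
apply: le_trans (ler_normD _ _) _; rewrite addrC; apply: lerD.
  by apply: KM => //; rewrite ltrDl.
by rewrite distrC ltW.
Qed.

End cutoff.

(** * The local Besov condition *)

Section localization.
Context (R : realType) (k m : nat) (q r : R).
Hypothesis q1 : 1 <= q.
Hypothesis r0 : 0 < r.
Hypothesis rq : r <= q.
Local Notation V := 'rV[R]_k.+1.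
Local Notation W := 'rV[R]_m.
Local Notation T := (lebesgueType R k.+1).
Local Notation leb := (lebesgue_rV R k.+1).
Local Notation HM := (hausdorff R k.+1 k).
Local Notation sphere := (@unit_sphere R k.+1).
Local Open Scope ereal_scope.
Implicit Types (u : V -> W) (G Omega K : set V).

Let C : R := (2 `^ q)%R.
Let C1 : (1 <= C)%R. Proof. exact: powR2_ge1. Qed.
Let C0 : (0 < C)%R. Proof. exact: lt_le_trans ltr01 C1. Qed.
Let q0 : (0 <= q)%R. Proof. exact: le_trans ler01 q1. Qed.
Let qn0 : q != 0%R. Proof. by rewrite gt_eqF// (lt_le_trans ltr01). Qed.

Lemma sphere_energy_in_le u v G (t : R) : (forall x, G x -> v x = u x) ->
  sphere_energy_in G q r u t <= sphere_energy q r v t.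
Proof.
move=> vu; apply: ge0_le_integral_nonmeasurable => n _.
  apply: integral_ge0 => x _; rewrite lee_fin mulr_ge0// divr_ge0 ?powR_ge0//.
rewrite integral_mkcond; apply: ge0_le_integral_nonmeasurable => x _.
  rewrite /patch; case: ifPn => // _.
  by rewrite lee_fin mulr_ge0// divr_ge0 ?powR_ge0.
rewrite /patch; case: ifPn => [|_]; last by rewrite lee_fin divr_ge0 ?powR_ge0.
rewrite inE => Gx; rewrite lee_fin indicE; have [Gxn|Gxn] := boolP (_ \in G).
  by rewrite mul1r !vu//; move: Gxn; rewrite inE.
by rewrite mul0r divr_ge0 ?powR_ge0.
Qed.

Definition cutoff_mul (eta : V -> R) u : V -> W := fun x => (eta x *: u x)%R.

Section cutoff_function.
Variables (Omega G : set V) (u : V -> W) (eta : V -> R) (d L : R).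
Hypotheses (oOmega : open Omega) (oG : open G).
Hypothesis Gin : compactly_inside G Omega.
Hypothesis uloc : Lq_loc q Omega u.
Hypothesis (d0 : (0 < d)%R) (L0 : (0 < L)%R).
Hypothesis eta01 : forall x, (0 <= eta x <= 1)%R.
Hypothesis etaL : forall x y, (`|eta x - eta y| <= L * enorm (x - y))%R.
Hypothesis etaG : forall x y, eta x != 0%R -> (enorm (y - x) < d)%R -> G y.

Let GO : G `<=` Omega.
Proof. by move=> x Gx; apply: Gin.2; exact: subset_closure. Qed.

Let mG : measurable (G : set T). Proof. exact: measurable_open. Qed.

Let etaGx x : eta x != 0%R -> G x.
Proof. by move=> /etaG; apply; rewrite subrr enorm0. Qed.

Let measurable_uG : measurable_on G u.
Proof.
have mO : measurable (Omega : set T) by exact: measurable_open.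
move=> j; exact: (measurable_funS mO GO (uloc.1 j)).
Qed.

Let EG : \bar R := \int[leb]_(x in G) (enorm (u x) `^ q)%:E.

Let EG_ge0 : 0 <= EG.
Proof. by apply: integral_ge0 => x _; rewrite lee_fin powR_ge0. Qed.

Let EG_fin : EG \is a fin_num.
Proof.
rewrite ge0_fin_numE//; apply: le_lt_trans (uloc.2 _ Gin.1 Gin.2).
rewrite /EG integral_mkcond [leRHS]integral_mkcond.
apply: ge0_le_integral_nonmeasurable => x _; rewrite /patch.
  by case: ifPn => // _; rewrite lee_fin powR_ge0.
case: ifPn => [|_].
  by rewrite inE => /subset_closure Gx; rewrite mem_set.
by case: ifPn => // _; rewrite lee_fin powR_ge0.
Qed.

(** Outside of Omega the values of u are arbitrary, but there eta vanishes: eta u is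
    the extension by zero of a function on G. *)
Lemma Lq_cutoff_mul : Lq q (cutoff_mul eta u).
Proof.
apply/(LqP q1); split.
  move=> j.
  have meta : measurable_fun [set: T] (eta : T -> R).
    by apply: continuous_measurable; exact: lipschitz_continuous etaL.
  have -> : (fun x => cutoff_mul eta u x 0 j)%R = ((fun x => eta x * u x 0 j)%R : T -> R) \_ G.
    apply/funext => x; rewrite /cutoff_mul mxE /patch; case: ifPn => // /negP xG.
    have [->|/etaGx Gx] := eqVneq (eta x) 0%R; first by rewrite mul0r.
    by case: xG; rewrite inE.
  apply/(measurable_restrictT _ mG).
  exact: (measurable_funM (measurable_funTS meta) (measurable_uG j)).
apply: (@le_lt_trans _ _ EG); last by rewrite -ge0_fin_numE.
rewrite /EG integral_mkcond; apply: ge0_le_integral_nonmeasurable => x _.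
  by rewrite lee_fin powR_ge0.
rewrite /patch; case: ifPn => [_|/negP xG].
  rewrite lee_fin; apply: (ge0_ler_powR q0); rewrite ?nnegrE ?enorm_ge0//.
  have /andP[e0 e1] := eta01 x.
  by rewrite /cutoff_mul enormZ ger0_norm// ler_piMl// enorm_ge0.
have [e0|/etaGx Gx] := eqVneq (eta x) 0%R; last by case: xG; rewrite inE.
by rewrite /cutoff_mul e0 scale0r enorm0 powR0.
Qed.

(** A difference of eta u splits into eta times a difference of u, which only
    involves points of G, and a difference of eta times u, which the Lipschitz
    bound makes negligible because r <= q. *)
Lemma cutoff_mul_increment_le (h x : V) : (enorm h < d)%R ->
  (enorm (cutoff_mul eta u (x + h) - cutoff_mul eta u x) <=
   \1_G x * (\1_G (x + h) * enorm (u (x + h) - u x))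
   + \1_G x * (L * enorm h * enorm (u x)))%R.
Proof.
move=> hd.
have -> : (cutoff_mul eta u (x + h) - cutoff_mul eta u x = eta (x + h) *: (u (x + h) - u x)
    + (eta (x + h) - eta x) *: u x)%R.
  by apply/rowP => j; rewrite !mxE; ring.
apply: le_trans (enormD _ _) _; rewrite !enormZ; apply: lerD.
  have [->|e0] := eqVneq (eta (x + h)%R) 0%R.
    by rewrite normr0 mul0r !mulr_ge0 ?enorm_ge0.
  have Gxh := etaGx e0; have Gx : G x.
    by apply: (etaG e0); rewrite opprD addNKr enormN.
  rewrite !indicE !mem_set// !mul1r; have /andP[? ?] := eta01 (x + h)%R.
  by rewrite ger0_norm// ler_piMl// enorm_ge0.
have eh : (`|eta (x + h) - eta x| <= L * enorm h)%R.
  by apply: le_trans (etaL _ _) _; rewrite addrC addKr.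
have [Gx|nGx] := pselect (G x).
  by rewrite indicE mem_set// mul1r ler_wpM2r ?enorm_ge0.
have ex0 : eta x = 0%R by apply/eqP; apply: contra_notT nGx; exact: etaGx.
have exh0 : eta (x + h)%R = 0%R.
  apply/eqP; apply: contra_notT nGx => e0.
  by apply: (etaG e0); rewrite opprD addNKr enormN.
by rewrite ex0 exh0 subrr normr0 mul0r !mulr_ge0 ?enorm_ge0// ltW.
Qed.

(** For t <= 1 the factor t^q / t^r is at most 1. *)
Lemma cutoff_mul_inner_integral_le (n : V) (t : R) : (0 < t < d)%R -> (t <= 1)%R ->
  sphere n ->
  \int[leb]_x (enorm (cutoff_mul eta u (x + t *: n)%R - cutoff_mul eta u x) `^ q / t `^ r)%:E <=
  C%:E * (\int[leb]_(x in G) (\1_G (x + t *: n)%R *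
        (enorm (u (x + t *: n)%R - u x) `^ q / t `^ r))%:E
    + (L `^ q)%:E * EG).
Proof.
move=> /andP[t0 td] t1 Sn.
have tr0 : (0 < t `^ r)%R by rewrite powR_gt0.
have nt : enorm (t *: n) = t by rewrite enormZ Sn mulr1 gtr0_norm.
have ntd : (enorm (t *: n)%R < d)%R by rewrite nt.
have tqr : (t `^ q / t `^ r <= 1)%R.
  by rewrite ler_pdivrMr// mul1r; apply: ger_powR => //; rewrite t0 t1.
pose g x := ((L `^ q) * (enorm (u x) `^ q))%R.
have mg : measurable_fun (G : set T) (g : T -> R).
  exact: (measurable_funM (measurable_cst _) (measurable_enorm_powR q measurable_uG)).
pose f x := (\1_G (x + t *: n)%R * (enorm (u (x + t *: n)%R - u x) `^ q / t `^ r))%R.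
have f0 x : (0 <= f x)%R by rewrite mulr_ge0// divr_ge0 ?powR_ge0.
have g0 x : (0 <= g x)%R by rewrite mulr_ge0 ?powR_ge0.
have -> : (L `^ q)%:E * EG = \int[leb]_(x in G) (g x)%:E.
  have c0 : 0 <= (L `^ q)%:E :> \bar R by rewrite lee_fin powR_ge0.
  rewrite /EG -(ge0_integralZl leb mG
    (iffRL (measurable_EFinP _ _) (measurable_enorm_powR q measurable_uG)) _ c0).
    by [].
  by move=> x _; rewrite lee_fin powR_ge0.
apply: (@le_trans _ _ (C%:E * \int[leb]_x (((EFin \o f) \+ (EFin \o g)) \_ G) x)).
  apply: ge0_integral_le_scale => // x _.
  - by rewrite lee_fin divr_ge0 ?powR_ge0.
  - by rewrite /patch; case: ifPn => // _; rewrite /= -EFinD lee_fin addr_ge0.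
  have := cutoff_mul_increment_le x ntd; rewrite nt /patch.
  case: ifPn => [xG|xG]; last first.
    rewrite indicE (negbTE xG) !mul0r addr0 mule0 lee_fin => e0.
    have -> : enorm (cutoff_mul eta u (x + t *: n) - cutoff_mul eta u x) = 0%R.
      by apply/eqP; rewrite eq_le e0 enorm_ge0.
    by rewrite powR0// mul0r.
  rewrite indicE xG !mul1r => cu.
  rewrite /= -EFinD -EFinM lee_fin ler_pdivrMr//.
  have tL0 : (0 <= L * t * enorm (u x))%R by rewrite !mulr_ge0 ?enorm_ge0// ltW.
  have a0 : (0 <= \1_G (x + t *: n) * enorm (u (x + t *: n) - u x))%R.
    by rewrite mulr_ge0 ?enorm_ge0.
  apply: (@le_trans _ _ ((\1_G (x + t *: n) * enorm (u (x + t *: n) - u x)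
     + L * t * enorm (u x)) `^ q)%R).
    by apply: (ge0_ler_powR q0); rewrite ?nnegrE ?enorm_ge0 ?addr_ge0.
  apply: le_trans (powR_add_le q1 a0 tL0) _.
  rewrite -/C -[leRHS]mulrA.
  apply: ler_wpM2l; first exact: ltW.
  rewrite mulrDl; apply: lerD.
    rewrite /f powRM ?enorm_ge0// -!mulrA mulVf ?gt_eqF// mulr1.
    by rewrite indicE; case: (_ \in _); rewrite ?powR1 ?powR0// ?mul0r// mul1r.
  rewrite /g !powRM ?mulr_ge0 ?enorm_ge0 ?(ltW t0) ?(ltW L0)//.
  rewrite -!mulrA ler_wpM2l ?powR_ge0// mulrC ler_wpM2l ?powR_ge0//.
  by rewrite -[leRHS]mul1r -ler_pdivrMr.
rewrite -integral_mkcond; apply: lee_wpmul2l; first by rewrite lee_fin ltW.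
apply: (@ge0_integral_le_add _ T R leb G (EFin \o f) _ g mG mg).
- by move=> x _; exact: g0.
- by move=> x _; rewrite lee_fin f0.
- by move=> x _; rewrite /= -EFinD lee_fin addr_ge0.
- by move=> x _; exact: lexx.
Qed.

(** The inner integral of the hypothesis need not be measurable in the direction n,
    but the remainder c is constant, hence the two can be integrated separately. *)
Lemma besov_cutoff_mul (d' M : R) : (0 < d')%R -> (0 <= M)%R ->
  (forall t, (0 < t < d')%R -> sphere_energy_in G q r u t <= M%:E) ->
  besov q (r / q) (cutoff_mul eta u).
Proof.
move=> d'0 M0 uM.
have Sf := hausdorff_sphere_fin_num R k.
have S0 : (0 <= fine (HM sphere))%R by rewrite fine_ge0; [|exact: hausdorff_ge0].
pose c := (L `^ q * fine EG)%R.
have c0 : (0 <= c)%R by rewrite mulr_ge0 ?powR_ge0 ?fine_ge0.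
pose D : R := (Num.min d' (Num.min d 1))%R.
have D0 : (0 < D)%R by rewrite !lt_min d'0 d0 ltr01.
apply: (@besov_of_sphere_energy R k m q r q1 r0 _ D
  (C * (M + c * fine (HM sphere)))%R Lq_cutoff_mul D0).
  by apply: mulr_ge0; [exact: ltW|apply: addr_ge0 => //; exact: mulr_ge0].
move=> t /andP[t0]; rewrite !lt_min => /and3P[td' td t1].
pose F n : \bar R := \int[leb]_(x in G) (\1_G (x + t *: n)%R *
        (enorm (u (x + t *: n)%R - u x) `^ q / t `^ r))%:E.
have F0 n : 0 <= F n.
  by apply: integral_ge0 => x _; rewrite lee_fin mulr_ge0// divr_ge0 ?powR_ge0.
have mS := @measurable_unit_sphere R k.+1 k.
apply: (@le_trans _ _ (C%:E * \int[HM]_(n in sphere) (F n + c%:E))).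
  apply: ge0_integral_le_scale => // n Sn.
  - by apply: integral_ge0 => x _; rewrite lee_fin divr_ge0 ?powR_ge0.
  - by rewrite adde_ge0// lee_fin.
  - rewrite /c EFinM fineK//; apply: cutoff_mul_inner_integral_le => //.
      by rewrite t0.
    exact: ltW.
rewrite [leRHS]EFinM; apply: lee_wpmul2l; first by rewrite lee_fin ltW.
rewrite [leRHS]EFinD [X in _ + X]EFinM fineK// -(integral_cst HM mS c%:E).
apply: le_trans (@ge0_integral_le_add _ _ R HM sphere F _ (fun=> c) mS
  (measurable_cst _) _ _ _ _) _.
- by [].
- by move=> n _; exact: F0.
- by move=> n _; rewrite adde_ge0// lee_fin.
- by move=> n _; exact: lexx.
by rewrite leeD2r// uM// t0.
Qed.

End cutoff_function.

Theorem besov_loc_sphere_energyP Omega u : open Omega -> Lq_loc q Omega u ->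
  besov_loc q (r / q) Omega u <->
  forall G, open G -> compactly_inside G Omega ->
    limf_esup (sphere_energy_in G q r u) (0 : R)^'+ < +oo.
Proof.
move=> oO uloc; split=> [[_ uK] G oG [cG GO]|uG].
  have [v vB vu] := uK _ cG GO.
  have [M M0 vM] := besov_sphere_energy_le q1 vB.
  apply/limf_esup_right_ltyP; exists 1%R, M; split => // t /andP[t0 _].
  apply: le_trans (vM t t0); apply: sphere_energy_in_le => x Gx.
  by apply: vu; exact: subset_closure.
split => // K cK KO.
have [e e0 Ge] := near_set_compactly_inside cK oO KO.
have e2 : (0 < e / 2)%R by rewrite divr_gt0.
have [eta [eta01 etaK etaG etaL]] := cutoff_exists K e2.
have oG : open (near_set K e) by exact: open_near_set.
have /limf_esup_right_ltyP[d [M [d0 M0 uM]]] := uG _ oG Ge.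
exists (cutoff_mul eta u); last by move=> x Kx; rewrite /cutoff_mul etaK// scale1r.
apply: (@besov_cutoff_mul Omega (near_set K e) u eta (e / 2)%R (e / 2)^-1 oO oG Ge uloc
  e2 _ eta01 etaL _ d M d0 M0 uM); first by rewrite invr_gt0.
move=> x y /etaG[b Kb xb] yx; exists b => //.
rewrite (splitr e); apply: le_lt_trans (enorm_triangle x _ _) _.
exact: ltrD.
Qed.

End localization.

Theorem proposition1p1 (R : realType) (N m : nat) (hN : (1 <= N)%N)
    (hm : (1 <= m)%N) :
  (forall (q r : R) (u : 'rV[R]_N -> 'rV[R]_m),
     1 <= q -> 0 < r < q -> Lq q u ->
     (besov q (r / q) u <->
      (limf_esup (sphere_energy q r u) (0 : R)^'+ < +oo)%E))
  /\
  (forall (Omega : set 'rV[R]_N) (q r : R) (u : 'rV[R]_N -> 'rV[R]_m),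
     open Omega -> 1 <= q -> 0 < r < q -> Lq_loc q Omega u ->
     (besov_loc q (r / q) Omega u <->
      forall G : set 'rV[R]_N, open G -> compactly_inside G Omega ->
        (limf_esup (sphere_energy_in G q r u) (0 : R)^'+ < +oo)%E)).
Proof.
case: N hN => [//|k] _; split.
  by move=> q r u q1 /andP[r0 _]; exact: besov_sphere_energyP.
move=> Omega q r u oO q1 /andP[r0 /ltW rq].
exact: (besov_loc_sphere_energyP q1 r0 rq).
Qed.
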